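(* Let $\mu^{(0)}\subset\mu^{(1)}\subset\cdots\subset\mu^{(n)}\subset\cdots$ be a sequence of partitions with $\mu^{(n)}\vdash n$. Then for all integers $i,j\ge0$, the sequence $([GH_{\mu^{(n)}}]_{(i,j)})_n$ of $(i,j)$-bigraded components, with inclusions as connective maps, is uniformly representation stable.
   Context: For a partition $\nu\vdash n$ (identified with its Young diagram in French notation) and a cell $c\in\nu$, $l'(c)$ is the number of cells below $c$ in its column and $a'(c)$ is the number of cells to the left of $c$ in its row. Let $\Delta_\nu=\det\bigl(x_i^{l'(c)}y_i^{a'(c)}\bigr)_{1\le i\le n,\ c\in\nu}$, defined up to sign. The Garsia–Haiman module $GH_\nu$ is the $\mathbb{C}$-span of all (iterated, including zeroth order) partial derivatives of $\Delta_\nu$ in $\mathbb{C}[x_1,\dots,x_n,y_1,\dots,y_n]$; it is a bigraded $S_n$-module under the diagonal action $\sigma\cdot x_k=x_{\sigma(k)}$, $\sigma\cdot y_k=y_{\sigma(k)}$. $[\,\cdot\,]_{(i,j)}$ is the component of $y$-degree $i$ and $x$-degree $j$. If $\mu\subset\nu$ then $GH_\mu\subset GH_\nu$. For a partition $\lambda$ and $n\ge|\lambda|+\lambda_1$, $\lambda[n]:=(n-|\lambda|,\lambda_1,\lambda_2,\dots)\vdash n$, and $\mathbb{S}^{\nu}$ denotes the Specht module. A sequence of $\mathbb{C}[S_n]$-modules $V_n\cong\bigoplus_\lambda(\mathbb{S}^{\lambda[n]})^{\oplus c_{\lambda,n}}$ ($c_{\lambda,n}=0$ if $\lambda[n]$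 is undefined) with $S_n$-equivariant maps $\phi_n:V_n\to V_{n+1}$ satisfying $(n+1\ \ n+2)\cdot\phi_{n+1}\circ\phi_n=\phi_{n+1}\circ\phi_n$ is uniformly representation stable if there is $N$ such that for all $n\ge N$: $c_{\lambda,n}=c_{\lambda,n+1}$ for all $\lambda$, $\phi_n$ is injective, and the $S_{n+1}$-submodule generated by $\phi_n(V_n)$ is $V_{n+1}$. *)

(* Defs.v *)
From HB Require Import structures.
From mathcomp Require Import all_boot all_order all_algebra all_fingroup.
From mathcomp Require Import boolp reals.
From mathcomp Require Import complex mpoly.

Set Implicit Arguments.
Unset Strict Implicit.
Unset Printing Implicit Defensive.

Import GRing.Theory.
Local Open Scope ring_scope.

(* Left F[S_n]-modules.  Since [(s * t)%g] is "s, then t" for permutations in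
   MathComp, the composite "s after t" is [(t * s)%g], whence [rep_actM]. *)
Record rep (F : fieldType) (n : nat) := Rep {
  rep_sort :> lmodType F;
  rep_act : 'S_n -> rep_sort -> rep_sort;
  rep_act_linear : forall s, linear (rep_act s);
  rep_act1 : forall v, rep_act 1%g v = v;
  rep_actM : forall s t v, rep_act (t * s)%g v = rep_act s (rep_act t v) }.

Arguments rep_act {F n r}.
Arguments rep_act_linear {F n r}.
Arguments rep_act1 {F n r}.
Arguments rep_actM {F n r}.

HB.instance Definition _ F n (V : rep F n) s :=
  GRing.isLinear.Build F V V _ (@rep_act F n V s) (rep_act_linear s).

Definition is_submodule F n (V : rep F n) (S : V -> Prop) : Prop :=
  [/\ S 0, forall (a : F) u v, S u -> S v -> S (a *: u + v)
    & forall s v, S v -> S (rep_act s v)].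

Section Submodule.
Context (F : fieldType) (n : nat) (V : rep F n) (S : V -> Prop).

Definition sub_pred : {pred V} := [pred v | `[< S v >]].

Definition sub_sort of is_submodule S := {v : V | v \in sub_pred}.

Context (HS : is_submodule S).

Lemma sub_pred_closed : GRing.submod_closed sub_pred.
Proof.
case: HS => S0 SD _; split; first exact/asboolP.
by move=> a u v /asboolP Su /asboolP Sv; apply/asboolP/SD.
Qed.

HB.instance Definition _ := SubChoice.on (sub_sort HS).
HB.instance Definition _ := GRing.SubChoice_isSubLmodule.Build F V sub_pred
  (sub_sort HS) (GRing.submod_closed_semi sub_pred_closed).

Lemma sub_act_subproof s (v : sub_sort HS) : rep_act s (val v) \in sub_pred.
Proof. by case: HS => _ _ Ss; apply/asboolP/Ss/asboolP/(valP v). Qed.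

Definition sub_act s (v : sub_sort HS) : sub_sort HS :=
  exist (fun u => u \in sub_pred) _ (sub_act_subproof s v).

Lemma sub_act_linear s : linear (sub_act s).
Proof. by move=> a u v; apply: val_inj; rewrite /= !linearP. Qed.

Lemma sub_act1 v : sub_act 1%g v = v.
Proof. by apply: val_inj; rewrite /= rep_act1. Qed.

Lemma sub_actM s t v : sub_act (t * s)%g v = sub_act s (sub_act t v).
Proof. by apply: val_inj; rewrite /= rep_actM. Qed.

Definition subrep : rep F n := Rep sub_act_linear sub_act1 sub_actM.

Definition subrep_val (v : subrep) : V := val (v : sub_sort HS).

End Submodule.

Section DirectSum.
Context (F : fieldType) (n : nat) (I : eqType) (W : I -> rep F n).

Definition dprod_sort : Type := forall i, W i.

HB.instance Definition _ := Choice.copy dprod_sort (forall i, W i).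

Implicit Types u v w : dprod_sort.

Let dadd u v : dprod_sort := fun i => u i + v i.
Let dopp u : dprod_sort := fun i => - u i.
Let dzero : dprod_sort := fun i => 0.
Let dscale (a : F) u : dprod_sort := fun i => a *: u i.

Fact daddA : associative dadd.
Proof. by move=> u v w; apply: functional_extensionality_dep => i; apply: addrA. Qed.
Fact daddC : commutative dadd.
Proof. by move=> u v; apply: functional_extensionality_dep => i; apply: addrC. Qed.
Fact dadd0 : left_id dzero dadd.
Proof. by move=> u; apply: functional_extensionality_dep => i; apply: add0r. Qed.
Fact daddN : left_inverse dzero dopp dadd.
Proof. by move=> u; apply: functional_extensionality_dep => i; apply: addNr. Qed.

HB.instance Definition _ :=
  GRing.isZmodule.Build dprod_sort daddA daddC dadd0 daddN.

Fact dscaleA a b v : dscale a (dscale b v) = dscale (a * b) v.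
Proof. by apply: functional_extensionality_dep => i; apply: scalerA. Qed.
Fact dscale1 : left_id 1 dscale.
Proof. by move=> u; apply: functional_extensionality_dep => i; apply: scale1r. Qed.
Fact dscaleDr : right_distributive dscale +%R.
Proof. by move=> a u v; apply: functional_extensionality_dep => i; apply: scalerDr. Qed.
Fact dscaleDl v : {morph dscale^~ v : a b / a + b}.
Proof. by move=> a b; apply: functional_extensionality_dep => i; apply: scalerDl. Qed.

HB.instance Definition _ := GRing.Zmodule_isLmodule.Build F dprod_sort
  dscaleA dscale1 dscaleDr dscaleDl.

Definition dprod_act (s : 'S_n) u : dprod_sort := fun i => rep_act s (u i).

Fact dprod_act_linear s : linear (dprod_act s).
Proof. by move=> a u v; apply: functional_extensionality_dep => i; apply: linearP. Qed.
Fact dprod_act1 v : dprod_act 1%g v = v.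
Proof. by apply: functional_extensionality_dep => i; apply: rep_act1. Qed.
Fact dprod_actM s t v :
  dprod_act (t * s)%g v = dprod_act s (dprod_act t v).
Proof. by apply: functional_extensionality_dep => i; apply: rep_actM. Qed.

Definition dprod : rep F n := Rep dprod_act_linear dprod_act1 dprod_actM.

Definition finitely_supported (v : dprod) : Prop :=
  exists s : seq I, forall i, i \notin s -> (v : dprod_sort) i = 0.

Lemma finitely_supported_submodule : is_submodule finitely_supported.
Proof.
split=> [|a u v [su hu] [sv hv]|s v [sv hv]]; first by exists [::].
  exists (su ++ sv) => i; rewrite mem_cat negb_or => /andP[iu iv].
  rewrite -[LHS]/(a *: (u : dprod_sort) i + (v : dprod_sort) i).
  by rewrite hu // hv // scaler0 addr0.
by exists sv => i iv; rewrite -[LHS]/(rep_act s _) hv // linear0.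
Qed.

Definition dsum : rep F n := subrep finitely_supported_submodule.

End DirectSum.

Definition rep_iso F n (V W : rep F n) : Prop :=
  exists f : {linear V -> W},
    bijective f /\ forall s v, f (rep_act s v) = rep_act s (f v).

Definition span (F : fieldType) (V : lmodType F) (S : V -> Prop) (v : V) : Prop :=
  exists m (a : 'I_m -> F) (u : 'I_m -> V),
    (forall k, S (u k)) /\ v = \sum_(k < m) a k *: u k.

Definition generates F n (V : rep F n) (S : V -> Prop) : Prop :=
  forall W : V -> Prop, is_submodule W -> (forall v, S v -> W v) ->
  forall v, W v.

Lemma span_submodule F n (V : rep F n) (S : V -> Prop) :
  (forall s v, S v -> span S (rep_act s v)) -> is_submodule (span S).
Proof.
move=> Sact.
have span0 : span S 0.
  by exists 0, (fun=> 0), (fun=> 0); split=> [[]//|]; rewrite big_ord0.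
have spanP (a : F) u v : span S u -> span S v -> span S (a *: u + v).
  case=> [m1 [a1 [u1 [S1 ->]]]] [m2 [a2 [u2 [S2 ->]]]].
  exists (m1 + m2)%N, (fun k => match split k with
    inl k => a * a1 k | inr k => a2 k end),
    (fun k => match split k with inl k => u1 k | inr k => u2 k end).
  split=> [k|]; first by case: (split k).
  rewrite big_split_ord /= scaler_sumr; congr (_ + _); apply: eq_bigr => k _.
    by rewrite (unsplitK (inl k)) scalerA.
  by rewrite (unsplitK (inr k)).
split=> // s v [m [a [u [Su ->]]]].
rewrite linear_sum; elim/big_rec: _ => // k x _ Sx.
by rewrite linearZ; apply: spanP => //; apply: Sact.
Qed.

Definition is_part (nu : seq nat) : bool := sorted geq nu && (0 \notin nu)%N.

Definition intpart : Type := {nu : seq nat | is_part nu}.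

Definition parts (nu : intpart) : seq nat := val nu.

(* French notation: (r, c) is the cell in row r, counted from the bottom, and
   column c, counted from the left, both starting from 0. *)
Definition cells (nu : seq nat) : seq (nat * nat) :=
  [seq (r, c) | r <- iota 0 (size nu), c <- iota 0 (nth 0%N nu r)].

Definition below (nu : seq nat) (c : nat * nat) : nat :=
  count (fun d => (d.2 == c.2) && (d.1 < c.1)%N) (cells nu).

Definition on_left (nu : seq nat) (c : nat * nat) : nat :=
  count (fun d => (d.1 == c.1) && (d.2 < c.2)%N) (cells nu).

Definition diagram_sub (mu nu : intpart) : bool :=
  all (fun c => c \in cells (parts nu)) (cells (parts mu)).

Definition pad_defined (lam : intpart) (n : nat) : bool :=
  (sumn (parts lam) + head 0 (parts lam) <= n)%N.

(* lambda[n]; the only zero part that can occur when lambda[n] is defined is the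
   first one, for the empty partition and n = 0. *)
Definition pad (lam : intpart) (n : nat) : seq nat :=
  [seq p <- (n - sumn (parts lam))%N :: parts lam | p != 0%N].

Section Specht.
Context (F : fieldType) (n : nat) (nu : seq nat).

(* A tabloid is the family of the sets of entries of its rows. *)
Definition tabloid := {ffun 'I_(size nu) -> {set 'I_n}}.

Definition tabloid_act (s : 'S_n) (T : tabloid) : tabloid :=
  [ffun r => [set s x | x in T r]].

Lemma tabloid_act1 T : tabloid_act 1%g T = T.
Proof.
apply/ffunP => r; rewrite ffunE -[RHS]imset_id.
by apply: eq_imset => x; rewrite perm1.
Qed.

Lemma tabloid_actM s t T :
  tabloid_act (t * s)%g T = tabloid_act s (tabloid_act t T).
Proof.
apply/ffunP => r; rewrite !ffunE -imset_comp.
by apply: eq_imset => x; rewrite /= permM.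
Qed.

Definition tabloid_fun_act (s : 'S_n) (f : {ffun tabloid -> F^o}) :
  {ffun tabloid -> F^o} := [ffun T => f (tabloid_act s^-1%g T)].

Fact tabloid_fun_act_linear s : linear (tabloid_fun_act s).
Proof. by move=> a f g; apply/ffunP => T; rewrite !ffunE. Qed.
Fact tabloid_fun_act1 f : tabloid_fun_act 1%g f = f.
Proof. by apply/ffunP => T; rewrite ffunE invg1 tabloid_act1. Qed.
Fact tabloid_fun_actM s t f :
  tabloid_fun_act (t * s)%g f = tabloid_fun_act s (tabloid_fun_act t f).
Proof. by apply/ffunP => T; rewrite !ffunE invMg tabloid_actM. Qed.

(* The permutation module M^nu is the submodule of [tabloid_rep] spanned by the
   indicators of the tabloids of shape nu. *)
Definition tabloid_rep : rep F n :=
  Rep tabloid_fun_act_linear tabloid_fun_act1 tabloid_fun_actM.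

(* When nu is a partition of n, [t : 'S_n] encodes the Young tableau of shape nu
   in which the entry x lies in the cell of index [t x] in [cells nu].  For
   other nu the definitions below are meaningless. *)
Definition cell_of (t : 'S_n) (x : 'I_n) : nat * nat :=
  nth (0, 0)%N (cells nu) (t x).

Definition tabloid_of (t : 'S_n) : tabloid :=
  [ffun r : 'I_(size nu) => [set x | (cell_of t x).1 == r]].

Definition col_stab (t : 'S_n) : {set 'S_n} :=
  [set s : 'S_n | [forall x, (cell_of t (s x)).2 == (cell_of t x).2]].

Definition indic (T : tabloid) : {ffun tabloid -> F^o} := [ffun T' => (T' == T)%:R].

Definition polytabloid (t : 'S_n) : tabloid_rep :=
  \sum_(s in col_stab t) (-1) ^+ s *: indic (tabloid_act s (tabloid_of t)).

Definition is_polytabloid (v : tabloid_rep) : Prop :=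
  exists t : 'S_n, v = polytabloid t.

Lemma act_indic s T :
  tabloid_fun_act s (indic T) = indic (tabloid_act s T).
Proof.
apply/ffunP => T'; rewrite !ffunE; congr (_ : bool)%:R.
by apply/eqP/eqP => [<-|->]; rewrite -tabloid_actM ?mulVg ?mulgV tabloid_act1.
Qed.

Lemma tabloid_act_of s t :
  tabloid_act s (tabloid_of t) = tabloid_of (s^-1 * t)%g.
Proof.
apply/ffunP => r; rewrite !ffunE; apply/setP => x; rewrite inE.
apply/imsetP/idP => [[y + ->]|hx].
  by rewrite inE /cell_of permM permK.
by exists (s^-1%g x); rewrite ?permKV // inE; move: hx; rewrite /cell_of permM.
Qed.

Lemma act_polytabloid s t :
  rep_act s (polytabloid t) = polytabloid (s^-1 * t)%g.
Proof.
rewrite /polytabloid linear_sum [RHS](reindex_inj (conjg_inj s)) /=.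
apply: eq_big => [u|u _].
  rewrite !inE; apply/forallP/forallP => h x.
    move: (h (s^-1%g x)); rewrite /cell_of !permM.
    by rewrite permK.
  by move: (h (s x)); rewrite /cell_of !permM !permK.
have actZ a f : tabloid_fun_act s (a *: f) = a *: tabloid_fun_act s f.
  by apply/ffunP => T; rewrite !ffunE.
rewrite [LHS]actZ odd_permJ; congr (_ *: _).
rewrite act_indic -tabloid_act_of; congr indic.
by rewrite -!tabloid_actM conjgE mulgA mulgA mulgV mul1g.
Qed.

Lemma specht_submodule : is_submodule (span is_polytabloid).
Proof.
apply: span_submodule => s _ [t ->]; exists 1%N, (fun=> 1).
exists (fun=> polytabloid (s^-1 * t)%g); split; first by move=> _; eexists.
by rewrite big_ord1 scale1r act_polytabloid.
Qed.

Definition specht : rep F n := subrep specht_submodule.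

End Specht.

Definition last_swap (n : nat) : 'S_n.+2 := tperm (inord n) (inord n.+1).

(* The family of all [lift_perm ord_max ord_max s] is the standard copy of S_n
   in S_(n+1), fixing the last point. *)
Definition uniformly_rep_stable (F : fieldType) (V : forall n, rep F n)
    (phi : forall n, {linear V n -> V n.+1}) : Prop :=
  (forall n (s : 'S_n) v,
     phi n (rep_act s v) = rep_act (lift_perm ord_max ord_max s) (phi n v)) /\
  (forall n v,
     rep_act (last_swap n) (phi n.+1 (phi n v)) = phi n.+1 (phi n v)) /\
  exists c : intpart -> nat -> nat,
    (forall lam n, ~~ pad_defined lam n -> c lam n = 0%N) /\
    (forall n, rep_iso (V n)
       (dsum (fun k : {lam : intpart & 'I_(c lam n)} =>
                specht F n (pad (tag k) n)))) /\
    exists N, forall n, (N <= n)%N ->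
      [/\ forall lam, c lam n = c lam n.+1,
          injective (phi n)
        & generates (fun w => exists v, w = phi n v)].

(* F[x_1, ..., x_n, y_1, ..., y_n] is encoded as [{mpoly F[n + n]}]: the first n
   variables are the x's, the last n are the y's. *)
Definition xvar n (k : 'I_n) : 'I_(n + n) := lshift n k.
Definition yvar n (k : 'I_n) : 'I_(n + n) := rshift n k.

Definition xymap n m (f : 'I_n -> 'I_m) (k : 'I_(n + n)) : 'I_(m + m) :=
  match split k with inl k => xvar (f k) | inr k => yvar (f k) end.

Definition xysubst (F : fieldType) n m (f : 'I_n -> 'I_m)
    (p : {mpoly F[n + n]}) : {mpoly F[m + m]} :=
  p \mPo [tuple 'X_(xymap f k) | k < n + n].

Definition poly_incl (F : fieldType) n
    (p : {mpoly F[n + n]}) : {mpoly F[n.+1 + n.+1]} :=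
  xysubst (widen_ord (leqnSn n)) p.

Section GarsiaHaiman.
Context (F : fieldType) (n : nat).

Lemma xysubst_linear m (f : 'I_n -> 'I_m) : linear (@xysubst F n m f).
Proof. by move=> a p q; rewrite /xysubst linearP. Qed.

Lemma xysubstX m (f : 'I_n -> 'I_m) k :
  xysubst f 'X_k = 'X_(xymap f k) :> {mpoly F[m + m]}.
Proof. by rewrite /xysubst comp_mpolyXU -tnth_nth tnth_mktuple. Qed.

Definition poly_act (s : 'S_n) : {mpoly F[n + n]} -> {mpoly F[n + n]} :=
  xysubst s.

Lemma xymap_inj (s : 'S_n) : injective (xymap s).
Proof.
move=> k l; rewrite /xymap -{2}(splitK k) -{2}(splitK l).
case: (split k) (split l) => [a|a] [b|b] //= E.
- by rewrite (perm_inj (@lshift_inj n n _ _ E)).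
- by move/eqP: E; rewrite eq_lrshift.
- by move/eqP: E; rewrite eq_rlshift.
- by rewrite (perm_inj (@rshift_inj n n _ _ E)).
Qed.

Definition diag_perm (s : 'S_n) : 'S_(n + n) := perm (@xymap_inj s).

Lemma poly_actE s p : poly_act s p = msym (diag_perm s) p.
Proof.
apply: eq_bigr => m _; congr (_ * _); apply: mmap1_eq => k.
by rewrite tnth_mktuple permE.
Qed.

Lemma diag_perm1 : diag_perm 1 = 1%g.
Proof.
apply/permP => k; rewrite permE perm1 /xymap -[RHS]splitK.
by case: (split k) => a /=; rewrite perm1.
Qed.

Lemma diag_permM s t : diag_perm (s * t)%g = (diag_perm s * diag_perm t)%g.
Proof.
apply/permP => k; rewrite permM !permE /xymap.
by case: (split k) => a; rewrite ?(unsplitK (inl _)) ?(unsplitK (inr _)) permM.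
Qed.

Fact poly_act_linear s : linear (poly_act s).
Proof. exact: xysubst_linear. Qed.

Fact poly_act1 p : poly_act 1%g p = p.
Proof.
rewrite poly_actE diag_perm1; apply/mpolyP => m; rewrite mcoeff_sym.
by congr (p@_ _); apply/mnmP => k; rewrite mnmE perm1.
Qed.

Fact poly_actM s t p : poly_act (t * s)%g p = poly_act s (poly_act t p).
Proof.
rewrite !poly_actE diag_permM; apply/mpolyP => m; rewrite !mcoeff_sym.
by congr (p@_ _); apply/mnmP => k; rewrite !mnmE permM.
Qed.

Definition poly_rep : rep F n := Rep poly_act_linear poly_act1 poly_actM.

Context (nu : seq nat).

(* Only used when nu is a partition of n, in which case [cells nu] has size n.
   The order of the columns, hence the sign, is that of [cells nu]. *)
Definition Delta : {mpoly F[n + n]} :=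
  \det (\matrix_(k < n, l < n)
          let c := nth (0, 0)%N (cells nu) l in
          'X_(xvar k) ^+ below nu c * 'X_(yvar k) ^+ on_left nu c).

Definition GH : poly_rep -> Prop :=
  span (fun p : poly_rep => exists m, p = Delta^`M[m]).

Definition xdeg (m : 'X_{1..n + n}) : nat := \sum_(k < n) m (xvar k).
Definition ydeg (m : 'X_{1..n + n}) : nat := \sum_(k < n) m (yvar k).

(* i is the y-degree and j is the x-degree. *)
Definition bihomog (i j : nat) (p : {mpoly F[n + n]}) : Prop :=
  {in msupp p, forall m, ydeg m = i /\ xdeg m = j}.

Definition GH_comp (i j : nat) (p : poly_rep) : Prop := GH p /\ bihomog i j p.

Lemma xymap_x (s : 'S_n) k : diag_perm s (xvar k) = xvar (s k).
Proof. by rewrite permE /xymap (unsplitK (inl k)). Qed.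

Lemma xymap_y (s : 'S_n) k : diag_perm s (yvar k) = yvar (s k).
Proof. by rewrite permE /xymap (unsplitK (inr k)). Qed.

Lemma Delta_act s : poly_act s Delta = (-1) ^+ s *: Delta.
Proof.
rewrite /Delta /poly_act /xysubst -det_map_mx.
rewrite (_ : map_mx _ _ = row_perm s (\matrix_(k < n, l < n)
          let c := nth (0, 0)%N (cells nu) l in
          'X_(xvar k) ^+ below nu c * 'X_(yvar k) ^+ on_left nu c)).
  rewrite row_permE det_mulmx det_perm -mul_mpolyC.
  by rewrite rmorphXn /= rmorphN1.
apply/matrixP => k l; rewrite !mxE /= rmorphM !rmorphXn /=.
by rewrite -!/(xysubst s _) !xysubstX -!xymap_x -!xymap_y !permE.
Qed.

Lemma poly_act_deriv s m p : exists m',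
  poly_act s p^`M[m] = (poly_act s p)^`M[m'].
Proof.
pose D := diag_perm s.
exists [multinom m ((D^-1)%g k) | k < n + n].
rewrite !poly_actE -/D; apply/mpolyP => m'.
rewrite mcoeff_sym !mcoeff_mderivm mcoeff_sym; congr (p@_ _ *+ _).
  by apply/mnmP => k; rewrite !mnmE permK.
rewrite [RHS](reindex_inj (@perm_inj _ D)) /=; apply: eq_bigr => k _.
by rewrite !mnmE permK.
Qed.

Lemma GH_comp_submodule i j : is_submodule (GH_comp i j).
Proof.
have [G0 GD Gs] : is_submodule GH.
  apply: span_submodule => s _ [m ->]; rewrite /rep_act /=.
  have [m' ->] := poly_act_deriv s m Delta.
  exists 1%N, (fun=> (-1) ^+ s), (fun=> Delta^`M[m']).
  by split; [move=> _; exists m' | rewrite big_ord1 Delta_act linearZ].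
split=> [|a u v [Gu hu] [Gv hv]|s v [Gv hv]]; split; try by auto.
- by move=> m; rewrite msupp0.
- move=> m /msuppD_le; rewrite mem_cat => /orP[/msuppZ_le /hu|/hv] //.
move=> m; rewrite -[rep_act s v]/(poly_act s v) poly_actE.
rewrite mcoeff_msupp mcoeff_sym -mcoeff_msupp => /hv [<- <-].
rewrite /xdeg /ydeg.
split; rewrite (reindex_inj (@perm_inj _ s)) /=; apply: eq_bigr => k _.
  by rewrite mnmE xymap_y.
by rewrite mnmE xymap_x.
Qed.

Definition GH_rep (i j : nat) : rep F n := subrep (GH_comp_submodule i j).

End GarsiaHaiman.

(* Main.v *)
Require Import Defs.
From HB Require Import structures.
From mathcomp Require Import all_boot all_order all_algebra all_fingroup.
From mathcomp Require Import boolp reals.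
From mathcomp Require Import complex mpoly.

(**
The components V_n = [GH_{mu^(n)}]_(i,j) form an increasing chain: the cell c0 added to mu^(n)
is a corner of the new diagram, so differentiating Delta_{n+1} in x_{n+1} and y_{n+1} as often as
c0 prescribes kills every term of the expansion along the last row except the one of c0, and
leaves a nonzero multiple of Delta_n (cell_det_corner, GH_incl).  Nothing else about
Garsia-Haiman modules matters: taking coefficients embeds V_n into the functions on the words of
length n over a finite pointed alphabet (the letter at k being the pair of exponents of x_k and
y_k), supported on words with at most i + j letters other than the base letter.  Stability holds
for every chain of submodules S_n of such function spaces that is compatible with extension by
the base letter (word_family_stable).

For a tableau T of shape lambda[n], let a and b be its row sum and its signed column sum in the
group algebra.  The multiplicity of the Specht module of lambda[n] in S_n is the dimension of the
space a b S_n.  Two facts make these dimensions eventually constant.  Enlarging T by the entry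
n + 1 at the end of its first row does not change b, so extension followed by the new row sum maps
a b S_n to a' b' S_{n+1}; this map is injective, since on a word whose last letter is the base
letter the terms of the new row sum are all equal or zero.  And a vector of a b S_n is invariant
under the permutations of the first row, hence is determined by its values on the words whose
non-base letters all sit in the first |lambda| + i + j positions, when the lower rows of T are
filled first; this bounds the dimension independently of n.  So the dimension is eventually
constant, and from then on a' b' S_{n+1} comes from S_n.  Only finitely many lambda occur, because
a function in the image of b vanishes on a word with two base letters in one column of T, which
forces |lambda| <= i + j.  Generation follows: if a proper submodule of S_{n+1} contained S_n, its
orthogonal complement would contain a nonzero vector of some a' b' S_{n+1}, and these all lie in
the submodule generated by S_n.

What remains is that every submodule is a sum of Specht modules.  The only hard point is that a
nonzero representation Z satisfies b a Z <> 0 for some tableau (exists_tableau).  Among the set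
partitions of the points for which Z contains a nonzero vector v invariant under the permutations
preserving the blocks, choose one with the largest number of pairs of points in a common block.
Moving a point to a block that is at least as large as its own would increase that number, so the
corresponding symmetrization of v vanishes; these raising relations force b v <> 0, by a
positivity argument that adds one entry of the tableau at a time (col_gsum_neq0).  The usual
dominance argument then separates the different shapes.
*)

Set Implicit Arguments.
Unset Strict Implicit.
Unset Printing Implicit Defensive.

Import Order.TTheory GRing.Theory Num.Theory.
Local Open Scope ring_scope.

(** * Signed sums over permutations and invariant forms *)

(** For [e = true] this is the antisymmetrizer of [G], for [e = false] the plain sum; treating
    both at once shares the algebra of row sums and column sums. *)
HB.lock Definition gsum (F : fieldType) n (V : rep F n) (e : bool) (G : {set 'S_n})
    (v : V) : V :=
  \sum_(s in G) (-1) ^+ (e && odd_perm s) *: rep_act s v.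

Arguments gsum {F n V} e G v.

Section GroupSums.
Context (F : fieldType) (n : nat) (V : rep F n).
Implicit Types (e : bool) (G : {group 'S_n}) (u v : V) (s g : 'S_n).

Lemma gsumE e (G : {set 'S_n}) v :
  gsum e G v = \sum_(s in G) (-1) ^+ (e && odd_perm s) *: rep_act s v.
Proof. by rewrite gsum.unlock. Qed.

Lemma gsum_linear e (G : {set 'S_n}) : linear (@gsum F n V e G).
Proof.
move=> a u v; rewrite !gsumE scaler_sumr -big_split; apply: eq_bigr => s _ /=.
by rewrite linearP scalerDr !scalerA mulrC.
Qed.
HB.instance Definition _ e (G : {set 'S_n}) :=
  GRing.isLinear.Build F V V _ (@gsum F n V e G) (gsum_linear e G).

Lemma gsum_sum e (G : {set 'S_n}) I r (P : pred I) (f : I -> V) :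
  gsum e G (\sum_(i <- r | P i) f i) = \sum_(i <- r | P i) gsum e G (f i).
Proof. exact: linear_sum. Qed.

Lemma gsumZ e (G : {set 'S_n}) a v : gsum e G (a *: v) = a *: gsum e G v.
Proof. exact: linearZ. Qed.

Lemma gsum0 e (G : {set 'S_n}) : gsum e G (0 : V) = 0.
Proof. exact: linear0. Qed.

Lemma sign_sq (b : bool) : (-1) ^+ b * (-1) ^+ b = 1 :> F.
Proof. by rewrite -signr_addb addbb. Qed.

Lemma odd_sign_and e s t : e && odd_perm (s * t)%g =
  (e && odd_perm s) (+) (e && odd_perm t).
Proof. by rewrite odd_permM; case: e. Qed.

Lemma act_gsum e G g v : g \in G ->
  rep_act g (gsum e G v) = (-1) ^+ (e && odd_perm g) *: gsum e G v.
Proof.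
move=> gG; rewrite !gsumE linear_sum scaler_sumr /=.
rewrite [RHS](reindex_inj (mulIg g)) /=; apply: eq_big => [s|s _].
  by rewrite groupMr.
by rewrite linearZ rep_actM scalerA odd_sign_and signr_addb mulrCA sign_sq mulr1.
Qed.

Lemma gsum_act e G g v : g \in G ->
  gsum e G (rep_act g v) = (-1) ^+ (e && odd_perm g) *: gsum e G v.
Proof.
move=> gG; rewrite !gsumE scaler_sumr /=.
rewrite [RHS](reindex_inj (mulgI g)) /=; apply: eq_big => [s|s _].
  by rewrite groupMl.
by rewrite -rep_actM scalerA odd_sign_and signr_addb mulrA sign_sq mul1r.
Qed.

Lemma gsum_gsum e G v : gsum e G (gsum e G v) = #|G|%:R *: gsum e G v.
Proof.
rewrite {1}gsumE; under eq_bigr => s sG do rewrite act_gsum // scalerA sign_sq scale1r.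
by rewrite sumr_const scaler_nat.
Qed.

Lemma gsum_inv G v : (forall s, s \in G -> rep_act s v = v) ->
  gsum false G v = #|G|%:R *: v.
Proof.
move=> h; rewrite !gsumE; under eq_bigr => s sG do rewrite scale1r h //.
by rewrite sumr_const scaler_nat.
Qed.

Lemma gsum_comm e (G : {set 'S_n}) g v : (forall s, s \in G -> commute s g) ->
  gsum e G (rep_act g v) = rep_act g (gsum e G v).
Proof.
move=> h; rewrite !gsumE linear_sum; apply: eq_bigr => s sG /=.
rewrite linearZ /= -!rep_actM; congr (_ *: rep_act _ v).
by rewrite (h s sG).
Qed.

Lemma gsum_conj e (G H : {set 'S_n}) g v :
  (forall s, (s \in H) = ((s ^ g)%g \in G)) ->
  gsum e G (rep_act g v) = rep_act g (gsum e H v).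
Proof.
move=> h; rewrite !gsumE linear_sum [LHS](reindex_inj (conjg_inj g)) /=.
apply: eq_big => [s|s _]; first by rewrite h.
rewrite linearZ /= -!rep_actM odd_permJ; congr (_ *: rep_act _ _).
by rewrite conjgE !mulgA mulgV mul1g.
Qed.

End GroupSums.

Lemma gsum_submod (F : fieldType) n (V : rep F n) (S : V -> Prop) e (G : {set 'S_n}) v :
  is_submodule S -> S v -> S (gsum e G v).
Proof.
case=> S0 SD Ss Sv; rewrite !gsumE; elim/big_rec: _ => // s x _ Sx.
by apply: SD => //; apply: Ss.
Qed.

Lemma linear_fun_sum (F : fieldType) (V W : lmodType F) (f : V -> W) : linear f ->
  forall I r (P : pred I) (a : I -> F) (v : I -> V),
  f (\sum_(i <- r | P i) a i *: v i) = \sum_(i <- r | P i) a i *: f (v i).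
Proof.
move=> fl I r P a v; pose m := GRing.isLinear.Build F V W _ f fl.
rewrite -[f]/(HB.pack_for {linear V -> W} f m : V -> W) linear_sum.
by apply: eq_bigr => i _; rewrite linearZ.
Qed.

Lemma linear_funZ (F : fieldType) (V W : lmodType F) (f : V -> W) : linear f ->
  forall a v, f (a *: v) = a *: f v.
Proof.
move=> fl a v; have := linear_fun_sum fl (index_enum 'I_1) xpredT (fun=> a) (fun=> v).
by rewrite !big_ord1.
Qed.

Lemma linear_fun0 (F : fieldType) (V W : lmodType F) (f : V -> W) : linear f -> f 0 = 0.
Proof. by move=> fl; rewrite -(scale0r 0) linear_funZ // scale0r. Qed.

Lemma gsum_morph (F : fieldType) n (V W : rep F n) (f : V -> W) e
  (G : {set 'S_n}) v : linear f -> (forall s v, f (rep_act s v) = rep_act s (f v)) ->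
  f (gsum e G v) = gsum e G (f v).
Proof.
move=> fl h; rewrite !gsumE linear_fun_sum //.
by apply: eq_bigr => s _ /=; rewrite h.
Qed.

Section SubmoduleOps.
Context (F : fieldType) (n : nat) (V : rep F n) (S : V -> Prop).
Hypothesis HS : is_submodule S.

Lemma submod0 : S 0. Proof. by case: HS. Qed.
Lemma submodZ a v : S v -> S (a *: v).
Proof. by case: HS => S0 SD _ Sv; rewrite -[_ *: _]addr0; apply: SD. Qed.
Lemma submodD u v : S u -> S v -> S (u + v).
Proof. by case: HS => S0 SD _ Su Sv; rewrite -[u]scale1r; apply: SD. Qed.
Lemma submodA s v : S v -> S (rep_act s v).
Proof. by case: HS => _ _; apply. Qed.
Lemma submod_sum I r (P : pred I) (f : I -> V) : (forall i, P i -> S (f i)) ->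
  S (\sum_(i <- r | P i) f i).
Proof. by move=> h; elim/big_rec: _ => [|i x Pi Sx]; [exact: submod0|apply: submodD => //; apply: h]. Qed.
End SubmoduleOps.

Record invariant_form (F : numClosedFieldType) n (V : rep F n) := Herm {
  dot :> V -> V -> F;
  dot_lin : forall a u v w, dot (a *: u + v) w = a * dot u w + dot v w;
  dotC : forall u v, dot v u = (dot u v)^*;
  dot_ge0 : forall v, 0 <= dot v v;
  dot_eq0 : forall v, dot v v = 0 -> v = 0;
  dot_act : forall s u v, dot (rep_act s u) (rep_act s v) = dot u v }.

Section Hermitian.
Context (F : numClosedFieldType) (n : nat) (V : rep F n) (h : invariant_form V).
Implicit Types (e : bool) (G : {group 'S_n}) (u v w : V).

Lemma dotZl a u w : h (a *: u) w = a * h u w.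
Proof.
have h0 : h 0 w = 0.
  have := dot_lin h 1 0 0 w; rewrite scaler0 addr0 mul1r => /eqP.
  by rewrite -subr_eq0 opprD addrA subrr sub0r oppr_eq0 => /eqP.
by rewrite -[a *: u]addr0 dot_lin h0 addr0.
Qed.
Lemma dotDl u v w : h (u + v) w = h u w + h v w.
Proof. by rewrite -[u]scale1r dot_lin scale1r mul1r. Qed.
Lemma dot0l w : h 0 w = 0.
Proof. by rewrite -[0](scale0r 0) dotZl mul0r. Qed.
Lemma dotDr u v w : h w (u + v) = h w u + h w v.
Proof. by rewrite dotC dotDl rmorphD /= -!dotC. Qed.
Lemma dotZr a u w : h w (a *: u) = a^* * h w u.
Proof. by rewrite dotC dotZl rmorphM /= -!dotC. Qed.
Lemma dot0r w : h w 0 = 0.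
Proof. by rewrite dotC dot0l rmorph0. Qed.
Lemma dot_suml I r (P : pred I) (f : I -> V) w :
  h (\sum_(i <- r | P i) f i) w = \sum_(i <- r | P i) h (f i) w.
Proof. by elim/big_rec2: _ => [|i x y _ <-]; rewrite ?dot0l ?dotDl. Qed.
Lemma dot_sumr I r (P : pred I) (f : I -> V) w :
  h w (\sum_(i <- r | P i) f i) = \sum_(i <- r | P i) h w (f i).
Proof. by elim/big_rec2: _ => [|i x y _ <-]; rewrite ?dot0r ?dotDr. Qed.

Lemma dot_gsum e G u v : h (gsum e G u) v = h u (gsum e G v).
Proof.
rewrite !gsumE dot_suml dot_sumr (reindex_inj invg_inj); apply: eq_big => s.
  by rewrite groupV.
move=> _; rewrite dotZl dotZr odd_permV rmorphXn rmorphN1; congr (_ * _).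
by rewrite -(dot_act h s) -rep_actM mulVg rep_act1.
Qed.

Lemma dot_gsum_sq e G u : h (gsum e G u) (gsum e G u) = #|G|%:R * h (gsum e G u) u.
Proof. by rewrite -dot_gsum gsum_gsum dotZl. Qed.

(** A sum over a group is self-adjoint and proportional to a projection, so it cannot be nonzero
    at [u] and orthogonal to [u]. *)
Lemma dot_gsum_neq0 e G u : gsum e G u != 0 -> h (gsum e G u) u != 0.
Proof.
move=> nz; apply/eqP => E; move/eqP: nz; apply; apply: (@dot_eq0 _ _ _ h).
by rewrite dot_gsum_sq E mulr0.
Qed.

(** When [Q] is the orbit of [j] under a group [G] and [u] is invariant under the stabilizer of
    [j], this is the sum of the translates of [u] over the cosets of that stabilizer. *)
Definition coset_sum (Q : {set 'I_n}) j u := \sum_(i in Q) rep_act (tperm i j) u.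

Lemma coset_sum_inv G (Q : {set 'I_n}) j u s :
  (forall g x, g \in G -> x \in Q -> g x \in Q) ->
  (forall i, i \in Q -> tperm i j \in G) -> j \in Q ->
  (forall g, g \in G -> g j = j -> rep_act g u = u) ->
  s \in G -> rep_act s (coset_sum Q j u) = coset_sum Q j u.
Proof.
move=> GQ tG jQ ju sG; rewrite /coset_sum linear_sum /=.
rewrite [RHS](reindex_inj (@perm_inj _ s)) /=.
apply: eq_big => [i|i iQ].
  apply/idP/idP => [|siQ]; first exact: GQ.
  by rewrite -(permK s i); apply: GQ => //; rewrite groupV.
have e : rep_act (tperm i j * s * tperm (s i) j)%g u = u.
  apply: ju; first by rewrite !groupM ?tG // ?GQ.
  by rewrite !permM tpermR tpermL.
rewrite -[X in _ = rep_act _ X]e -!rep_actM; congr (rep_act _ u).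
by rewrite -!mulgA tperm2 mulg1.
Qed.

(** The coset sum is [#|Q|] times the orthogonal projection of [u] onto the [G]-invariants. *)
Lemma coset_sum_ge0 G (Q : {set 'I_n}) j u :
  (forall g x, g \in G -> x \in Q -> g x \in Q) ->
  (forall i, i \in Q -> tperm i j \in G) -> j \in Q ->
  (forall g, g \in G -> g j = j -> rep_act g u = u) ->
  0 <= h (coset_sum Q j u) u.
Proof.
move=> GQ tG jQ ju; set w := coset_sum Q j u.
have winv i : i \in Q -> rep_act (tperm i j) w = w.
  by move=> iQ; apply: (coset_sum_inv GQ tG jQ ju); apply: tG.
have E : h w w = #|Q|%:R * h w u.
  rewrite {2}/w /coset_sum dot_sumr -sumr_const mulr_suml; apply: eq_bigr => i iQ.
  by rewrite mul1r -{1}(winv i iQ) dot_act.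
have := dot_ge0 h w; rewrite E pmulr_rge0 // ltr0n card_gt0.
by apply/set0Pn; exists j.
Qed.

End Hermitian.

(** * Tableaux *)

Lemma mem_cells nu r c : ((r, c) \in cells nu) = (r < size nu)%N && (c < nth 0%N nu r)%N.
Proof.
apply/allpairsPdep/andP => [[r' [c' [+ + [-> ->]]]]|[hr hc]].
  by rewrite !mem_iota.
by exists r, c; rewrite !mem_iota.
Qed.

Lemma cells_uniq nu : uniq (cells nu).
Proof.
by apply: allpairs_uniq_dep => [|i _|[a b] [c d] _ _ [-> ->]] //; apply: iota_uniq.
Qed.

Lemma size_cells nu : size (cells nu) = sumn nu.
Proof.
rewrite size_allpairs_dep -[in RHS](mkseq_nth 0%N nu).
by congr sumn; apply: eq_map => i; rewrite size_iota.
Qed.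

Lemma nth_part nu r r' : is_part nu -> (r <= r')%N -> (nth 0 nu r' <= nth 0 nu r)%N.
Proof.
case/andP => so _ le; have [lt|ge] := ltnP r' (size nu); last by rewrite nth_default.
have tr : transitive geq by move=> a b c /= h1 h2; apply: leq_trans h2 h1.
apply: (sorted_leq_nth tr (@leqnn) 0%N so); rewrite ?inE //.
exact: leq_ltn_trans lt.
Qed.

Notation trow nu t x := (cell_of nu t x).1.
Notation tcol nu t x := (cell_of nu t x).2.

Definition row_stab n nu (t : 'S_n) : {set 'S_n} :=
  [set s : 'S_n | [forall x, trow nu t (s x) == trow nu t x]].

Section Stab.
Context (n : nat) (nu : seq nat) (t : 'S_n).

Lemma fiber_group_set (T : eqType) (f : 'I_n -> T) :
  group_set [set s : 'S_n | [forall x, f (s x) == f x]].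
Proof.
apply/group_setP; split=> [|s u]; first by rewrite inE; apply/forallP => x; rewrite perm1.
rewrite !inE => /forallP hs /forallP hu; apply/forallP => x.
by rewrite permM (eqP (hu _)) (eqP (hs _)).
Qed.

Canonical row_stab_group := Group (fiber_group_set (fun x => trow nu t x)).
Canonical col_stab_group : {group 'S_n} :=
  @Group _ (col_stab nu t) (fiber_group_set (fun x => tcol nu t x)).

Lemma row_stabP (s : 'S_n) : reflect (forall x, trow nu t (s x) = trow nu t x) (s \in row_stab nu t).
Proof. by rewrite inE; apply: (iffP forallP) => h x; apply/eqP. Qed.
Lemma col_stabP (s : 'S_n) : reflect (forall x, tcol nu t (s x) = tcol nu t x) (s \in col_stab nu t).
Proof. by rewrite inE; apply: (iffP forallP) => h x; apply/eqP. Qed.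

End Stab.

Section StabConj.
Context (n : nat) (nu : seq nat) (t : 'S_n).

Lemma cell_conj (s : 'S_n) x : cell_of nu (s^-1 * t)%g (s x) = cell_of nu t x.
Proof. by rewrite /cell_of permM permK. Qed.

Lemma row_stab_conj (s g : 'S_n) : (g \in row_stab nu t) = ((g ^ s)%g \in row_stab nu (s^-1 * t)%g).
Proof.
apply/row_stabP/row_stabP => E x.
  by rewrite -(permKV s x) permJ !cell_conj E.
by move: (E (s x)); rewrite permJ !cell_conj.
Qed.
Lemma col_stab_conj (s g : 'S_n) : (g \in col_stab nu t) = ((g ^ s)%g \in col_stab nu (s^-1 * t)%g).
Proof.
apply/col_stabP/col_stabP => E x.
  by rewrite -(permKV s x) permJ !cell_conj E.
by move: (E (s x)); rewrite permJ !cell_conj.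
Qed.

Hypothesis nun : sumn nu = n.

Lemma cell_mem x : cell_of nu t x \in cells nu.
Proof. by apply: mem_nth; rewrite size_cells nun. Qed.

Lemma cell_inj : injective (cell_of nu t).
Proof.
move=> x y /eqP; rewrite /cell_of nth_uniq ?size_cells ?nun ?cells_uniq //.
by move/eqP/ord_inj/perm_inj.
Qed.

Lemma cell_onto c : c \in cells nu -> exists x, cell_of nu t x = c.
Proof.
move=> hc; have hi : (index c (cells nu) < n)%N by rewrite -nun -size_cells index_mem.
by exists (t^-1%g (Ordinal hi)); rewrite /cell_of permKV /= nth_index.
Qed.

Lemma trow_lt x : (trow nu t x < size nu)%N.
Proof. by have := cell_mem x; rewrite (surjective_pairing (cell_of nu t x)) mem_cells => /andP[]. Qed.
Lemma tcol_lt x : (tcol nu t x < nth 0 nu (trow nu t x))%N.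
Proof. by have := cell_mem x; rewrite (surjective_pairing (cell_of nu t x)) mem_cells => /andP[]. Qed.

Lemma cell_at r c : (r < size nu)%N -> (c < nth 0 nu r)%N ->
  exists2 x, trow nu t x = r & tcol nu t x = c.
Proof.
move=> hr hc; have [|x E] := @cell_onto (r, c); first by rewrite mem_cells hr.
by exists x; rewrite E.
Qed.

Lemma tableau_eq x y : trow nu t x = trow nu t y -> tcol nu t x = tcol nu t y -> x = y.
Proof.
by move=> h1 h2; apply: cell_inj; rewrite [LHS]surjective_pairing h1 h2 -surjective_pairing.
Qed.

End StabConj.

Section ConjSum.
Context (F : fieldType) (n : nat) (V : rep F n) (nu : seq nat) (t : 'S_n) (s : 'S_n) (v : V).
Lemma row_gsum_conj : gsum false (row_stab nu (s^-1 * t)%g) (rep_act s v) =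
  rep_act s (gsum false (row_stab nu t) v).
Proof. by apply: gsum_conj => g; rewrite (row_stab_conj nu t s). Qed.
Lemma col_gsum_conj : gsum true (col_stab nu (s^-1 * t)%g) (rep_act s v) =
  rep_act s (gsum true (col_stab nu t) v).
Proof. by apply: gsum_conj => g; rewrite (col_stab_conj nu t s). Qed.
End ConjSum.

Section Nonvanishing.
Context (F : numClosedFieldType) (n : nat) (V : rep F n) (h : invariant_form V).
Context (nu : seq nat) (nun : sumn nu = n) (t : 'S_n) (v : V).
Hypothesis v_neq0 : v != 0.
Hypothesis v_row : forall s, s \in row_stab nu t -> rep_act s v = v.
Hypothesis v_raise : forall p j, (p < trow nu t j)%N ->
  v + \sum_(i | trow nu t i == p) rep_act (tperm i j) v = 0.

Notation row x := (trow nu t x).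
Notation col x := (tcol nu t x).

(* Entries are compared column by column, and within a column from the bottom up. *)
Let key x := (col x * size nu + row x)%N.

Let key_col x y : (col x < col y)%N -> (key x < key y)%N.
Proof.
move=> hc; apply: leq_trans (_ : (col x).+1 * size nu <= _)%N.
  by rewrite mulSn /key [(size nu + _)%N]addnC ltn_add2l trow_lt.
by apply: leq_trans (leq_addr _ _); rewrite leq_mul2r hc orbT.
Qed.

Let key_inj : injective key.
Proof.
move=> x y E; apply: (tableau_eq nun (t := t)).
  case: (ltngtP (col x) (col y)) => [/key_col|/key_col|hc]; rewrite ?E ?ltnn //.
  by move/eqP: E; rewrite /key hc eqn_add2l => /eqP.
by case: (ltngtP (col x) (col y)) => [/key_col|/key_col|hc]; rewrite ?E ?ltnn.
Qed.

Let CP (P : {set 'I_n}) : {group 'S_n} := (col_stab_group nu t :&: Sym_group P)%G.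

Let CPP P (s : 'S_n) : reflect ((forall x, col (s x) = col x) /\ perm_on P s) (s \in CP P).
Proof.
rewrite inE [X in _ && X]inE; apply: (iffP andP) => -[h1 h2]; split=> //.
  by apply/col_stabP.
by apply/(col_stabP nu t).
Qed.

Let CP_tperm (P : {set _}) x y : x \in P -> y \in P -> col x = col y -> tperm x y \in CP P.
Proof.
move=> xP yP E; apply/CPP; split; last first.
  apply: subset_trans (tperm_on x y) _.
  by apply/subsetP => z; rewrite !inE => /orP[] /eqP->.
by move=> z; case: tpermP => // ->.
Qed.

(* The permutations of [P] are sorted by the preimage [y] of [c]. *)
Let CP_step (P : {set 'I_n}) c (w : V) : c \in P ->
  gsum true (CP P) w = \sum_(y in P | col y == col c)
     (-1) ^+ (y != c) *: gsum true (CP (P :\ c)) (rep_act (tperm y c) w).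
Proof.
move=> cP; rewrite {1}gsumE.
rewrite (partition_big (fun s : 'S_n => s^-1%g c)
  (fun y => (y \in P) && (col y == col c))) => [|s sC] /=; last first.
  have /CPP[h1 h2] : (s^-1)%g \in CP P by rewrite groupV.
  by rewrite perm_closed // cP h1 eqxx.
apply: eq_bigr => y /andP[yP /eqP yc].
rewrite !gsumE scaler_sumr [LHS](reindex_inj (mulgI (tperm y c))) /=.
have tC : tperm y c \in CP P by apply: CP_tperm.
apply: eq_big => [g|g _]; last first.
  by rewrite rep_actM scalerA odd_permM odd_tperm signr_addb.
rewrite groupMl // invMg permM tpermV.
apply/andP/idP => [[/CPP[g1 g2] /eqP E]|/CPP[g1 g2]].
  have gc : g c = c.
    have g'c : (g^-1)%g c = c by rewrite -[LHS](tpermK y c) E tpermL.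
    by rewrite -{1}g'c permKV.
  apply/CPP; split=> //; apply/subsetP => x; rewrite !inE => xg.
  have xP : x \in P by apply: (subsetP g2); rewrite inE.
  by rewrite xP andbT; apply: contra xg => /eqP->; rewrite gc.
have gc : g c = c by apply: (out_perm g2); rewrite !inE eqxx.
have g'c : (g^-1)%g c = c by rewrite -{1}gc permK.
split; last by rewrite g'c tpermR.
apply/CPP; split=> //; apply: subset_trans g2 _; exact: subD1set.
Qed.

(** Let [c] be the last entry of an initial segment [P] of the column reading order, and [u] the
    alternating sum of [v] over the column permutations of [P] minus [c].  Expanding the
    alternating sum over [P] along [c] gives [u] minus the terms of the transpositions of [c] with
    the entries [y] above or below it already in [P]; the raising relation of the row of [y]
    turns each of these into a coset sum at [c] over the part of that row outside [P].  Coset sums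
    are nonnegative against [u], so the sum over [P] has a scalar product at least [<u, u>] with
    [u], and does not vanish. *)
Lemma col_gsum_neq0 : gsum true (col_stab nu t) v != 0.
Proof.
suff H m (P : {set 'I_n}) : #|P| = m ->
    (forall x y, x \in P -> (key y < key x)%N -> y \in P) ->
    gsum true (CP P) v != 0.
  have -> : col_stab nu t = CP [set: 'I_n].
    apply/setP => s; apply/(col_stabP nu t s)/CPP => [sc|[]//].
    by split=> //; apply/subsetP => x; rewrite inE.
  by apply: (H #|[set: 'I_n]|) => // x y _ _; rewrite inE.
elim: m P => [|m IH] P cardP Pini.
  have -> : gsum true (CP P) v = v; last by [].
  rewrite !gsumE (bigD1 1%g) ?group1 //= big1 ?addr0 => [|s /andP[/CPP[_ sP] s1]].
    by rewrite odd_perm1 scale1r rep_act1.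
  by case/eqP: s1; apply: (perm_on_id sP); rewrite cardP.
have [x0 x0P] : exists x, x \in P by apply/set0Pn; rewrite -card_gt0 cardP.
case: (arg_maxnP key x0P) => c cP' cmaxg.
have cP : c \in P := cP'.
have cmax y : y \in P -> (key y <= key c)%N by move/cmaxg.
have cmax_lt y : y \in P -> y != c -> (key y < key c)%N.
  by move=> yP yc; rewrite ltn_neqAle cmax // andbT; apply: contra yc => /eqP/key_inj->.
have P'card : #|P :\ c| = m by move: cardP; rewrite (cardsD1 c) cP => -[].
have u_neq0 : gsum true (CP (P :\ c)) v != 0.
  apply: IH => // x y; rewrite !inE => /andP[xc xP] yx.
  rewrite (Pini x) // andbT; apply: contraTneq yx => ->.
  by rewrite -leqNgt cmax.
set u := gsum true _ v in u_neq0.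
pose B (w : V) := gsum true (CP (P :\ c)) w.
pose Q y := c |: [set i | (row i == row y) && (i \notin P)].
have B_comm i : i \notin P -> B (rep_act (tperm i c) v) = rep_act (tperm i c) u.
  move=> iP; apply: gsum_comm => s /CPP[_ sP].
  apply: (perm_onC sP (tperm_on i c)).
  rewrite -setI_eq0; apply/eqP/setP => x; rewrite !inE.
  have [->|xc] //= := eqVneq x c; rewrite ?orbF. 
  by have [->|_] := eqVneq x i; rewrite ?(negbTE iP) ?andbF.
(* In a completed column, the entry [c'] of the row of [c] lies in that same row, so [v] is fixed
   by the transposition of [c] and [c']; this makes the term equal to its own image under a
   transposition of column entries, hence to its opposite. *)
have B_zero i : i \in P -> (row i < row c)%N -> (col i < col c)%N ->
    B (rep_act (tperm i c) v) = 0.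
  move=> iP ri ci.
  have [c' rc' cc'] : exists2 x, row x = row c & col x = col i.
    by apply: cell_at => //; [exact: trow_lt | exact: ltn_trans (tcol_lt t nun c)].
  have c'P : c' \in P by apply: (Pini c) => //; apply: key_col; rewrite cc'.
  have ic' : i != c'.
    by apply: contraTneq ri => ->; rewrite rc' ltnn.
  have c'c : c' != c by apply: contraTneq ci => <-; rewrite cc' ltnn.
  have ic : i != c by apply: contraTneq ci => ->; rewrite ltnn.
  have tC : tperm c' i \in CP (P :\ c) by apply: CP_tperm; rewrite ?inE ?c'c ?ic.
  have tv : rep_act (tperm c c') v = v.
    by apply: v_row; apply/row_stabP => x; case: tpermP => // ->.
  have E : rep_act (tperm i c) v = rep_act (tperm c' i) (rep_act (tperm i c) v).
    rewrite -{1}tv -!rep_actM conjgC tpermJ tpermR tpermD // 1?eq_sym //.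
    by rewrite (tpermC i c').
  have : B (rep_act (tperm i c) v) = - B (rep_act (tperm i c) v).
    rewrite {1}E /B gsum_act // odd_tperm eq_sym ic' /= expr1 scaleN1r //.
  move/eqP; rewrite -addr_eq0 -mulr2n -scaler_nat scaler_eq0 pnatr_eq0 /=.
  by move/eqP.
have B_swap y : y \in P -> y != c -> col y = col c ->
    - B (rep_act (tperm y c) v) = coset_sum (Q y) c u.
  move=> yP yc cyc.
  have ry : (row y < row c)%N.
    have := cmax_lt y yP yc; rewrite /key cyc ltn_add2l //.
  have := congr1 B (v_raise ry).
  rewrite /B [X in _ = X]linear0 linearD linear_sum /= -/u => /eqP.
  rewrite (bigID (fun i => i \in P)) /= (bigD1 y) /=; last by rewrite eqxx.
  rewrite big1 => [|i /andP[/andP[/eqP ri iP] iy]]; last first.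
    apply: B_zero => //; first by rewrite ri.
    have := cmax i iP; rewrite leqNgt; case: (ltngtP (col i) (col c)) => // [/key_col->//|ci].
    by case/eqP: iy; apply: (tableau_eq nun (t := t)) => //; rewrite ci.
  rewrite addr0 addrCA addr_eq0 => /eqP ->; rewrite opprK /coset_sum.
  rewrite big_setU1 ?inE ?cP ?andbF //= tperm1 rep_act1; congr (_ + _).
  apply: eq_big => [i|i /andP[_ iP]]; first by rewrite inE.
  exact: B_comm.
suff gt0 : 0 < h (gsum true (CP P) v) u.
  by apply: contraTneq gt0 => ->; rewrite dot0l ltxx.
rewrite (CP_step v cP) (bigD1 c) ?cP ?eqxx //= scale1r tperm1 rep_act1 -/u.
have uu : 0 < h u u.
  have := dot_ge0 h u; rewrite le0r => /orP[/eqP/dot_eq0 u0|//].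
  by rewrite u0 eqxx in u_neq0.
rewrite dotDl [X in _ + X]dot_suml; apply: (lt_le_trans uu); rewrite lerDl.
apply: sumr_ge0 => y /andP[/andP[yP /eqP yc] ync].
rewrite ync expr1 scaleN1r B_swap //.
apply: (coset_sum_ge0 h (G := Sym_group (Q y))).
- by move=> g x; rewrite inE => gQ xQ; rewrite perm_closed.
- move=> i iQ; rewrite inE; apply: subset_trans (tperm_on i c) _.
  by apply/subsetP => z; rewrite !inE => /orP[] /eqP->; rewrite ?eqxx //; move: iQ; rewrite !inE.
- by rewrite !inE eqxx.
move=> g; rewrite inE => gQ gc.
have gD : perm_on (Q y :\ c) g.
  apply/subsetP => x; rewrite inE => gx.
  rewrite in_setD1 (subsetP gQ) ?inE // andbT.
  by apply: contra gx => /eqP->; rewrite gc.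
have gv : rep_act g v = v.
  apply: v_row; apply/row_stabP => x; have [xQ|/(out_perm gD)->//] := boolP (x \in Q y :\ c).
  have : g x \in Q y :\ c by rewrite perm_closed.
  by move: xQ; rewrite !inE => /andP[/negbTE-> /= /andP[/eqP-> _]] /andP[/negbTE-> /= /andP[/eqP-> _]].
rewrite -[X in _ = X]/(gsum true _ _) -{1}gv gsum_comm // => s /CPP[_ sP].
apply: (perm_onC sP gD); rewrite -setI_eq0; apply/eqP/setP => x; rewrite !inE.
by case: eqP => //= _; case: (x \in P); rewrite ?andbF.
Qed.

End Nonvanishing.

(** * Existence of a tableau with nonzero Young operator *)

Lemma card_le_match (T : finType) (K : eqType) (A B : {set T}) (f g : T -> K) :
  {in A &, injective f} -> (forall x, x \in A -> exists2 y, y \in B & g y = f x) ->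
  (#|A| <= #|B|)%N.
Proof.
move=> finj hAB; pose m x := odflt x [pick y in B | g y == f x].
have mP x : x \in A -> m x \in B /\ g (m x) = f x.
  move=> xA; rewrite /m; case: pickP => [y /andP[yB /eqP]//|no].
  by have [y yB e] := hAB x xA; have := no y; rewrite yB e eqxx.
rewrite -(card_in_imset (f := m) (D := A)); last first.
  move=> x y xA yA e; apply: finj => //.
  by rewrite -(mP x xA).2 -(mP y yA).2 e.
by apply: subset_leq_card; apply/subsetP => _ /imsetP[x /mP[? _] ->].
Qed.

(** The blocks are listed by decreasing size, so that their sizes form a partition, and the points
    are listed block after block; this list runs parallel to the row-by-row list of cells. *)
Lemma tableau_of_fibers n (r : 'I_n -> 'I_n) : exists (nu : seq nat) (t : 'S_n),
  [/\ is_part nu, sumn nu = n &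
      forall x y, (trow nu t x == trow nu t y) = (r x == r y)].
Proof.
pose f i := [seq x <- enum 'I_n | r x == i].
pose s := sort (fun i k => size (f k) <= size (f i))%N [seq i <- enum 'I_n | f i != [::]].
pose nu := [seq size (f i) | i <- s].
pose L := [seq x | i <- s, x <- f i].
have s_mem i : (i \in s) = (f i != [::]) by rewrite mem_sort mem_filter mem_enum andbT.
have s_uniq : uniq s by rewrite sort_uniq filter_uniq // enum_uniq.
have fx x : x \in f (r x) by rewrite mem_filter eqxx mem_enum.
have rs x : r x \in s by rewrite s_mem; apply: contraTneq (fx x) => ->.
have L_mem x : x \in L by apply/allpairsPdep; exists (r x), x.
have L_uniq : uniq L.
  apply: allpairs_uniq_dep => // [i _|[i x] [k y]]; first by rewrite filter_uniq ?enum_uniq.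
  move=> /allpairsPdep[i' [x' [_ + [-> ->]]]] /allpairsPdep[k' [y' [_ + [-> ->]]]] /=.
  by rewrite !mem_filter => /andP[/eqP<- _] /andP[/eqP<- _] ->.
have L_size : size L = n.
  apply: etrans (size_enum_ord n); apply/perm_size/uniq_perm; rewrite ?enum_uniq // => x.
  by rewrite L_mem mem_enum.
have nuP : is_part nu.
  apply/andP; split; last first.
    by apply/negP; case/mapP => i; rewrite s_mem => /eqP + /esym/size0nil.
  rewrite sorted_map; apply: sort_sorted => i k /=.
  by apply: leq_total.
have nun : sumn nu = n.
  by rewrite -L_size size_allpairs_dep.
have ltL x : (index x L < n)%N by rewrite -[X in (_ < X)%N]L_size index_mem.
pose t0 x := Ordinal (ltL x).
have t0_inj : injective t0.
  by move=> x y [] /(congr1 (nth x L)); rewrite !nth_index.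
exists nu, (perm t0_inj).
suff rowE x0 : trow nu (perm t0_inj) x0 = index (r x0) s.
  split=> // x y; rewrite !rowE; apply/eqP/eqP => [|-> //].
  by move/(congr1 (nth x s)); rewrite !nth_index.
have -> : trow nu (perm t0_inj) x0 = nth 0%N (map fst (cells nu)) (index x0 L).
  rewrite (nth_map (0, 0)%N) ?size_cells ?nun ?ltL //.
  by rewrite /cell_of permE.
have const_map (T : Type) k (l : seq T) : [seq k | _ <- l] = nseq (size l) k :> seq nat.
  by elim: l => //= ? l ->.
have -> : map fst (cells nu) = map (fun y => index (r y) s) L.
  have -> : [seq index (r y) s | y <- L] = [seq index i s | i <- s, x <- f i].
    rewrite map_allpairs; congr flatten; apply/eq_in_map => i _; apply/eq_in_map => y.
    by rewrite mem_filter => /andP[/eqP-> _].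
  rewrite map_allpairs.
  have {2}-> : s = [seq nth x0 s i | i <- iota 0 (size s)] by rewrite -[LHS](mkseq_nth x0).
  rewrite -map_comp size_map; congr flatten; apply/eq_in_map => i; rewrite mem_iota add0n /= => ilt.
  by rewrite !const_map size_iota /nu (nth_map x0) // index_uniq.
by rewrite (nth_map x0) ?index_mem // nth_index.
Qed.

Lemma leq_nth_sumn nu k : (nth 0 nu k <= sumn nu)%N.
Proof.
elim: nu k => [|a nu IH] [|k] //=; first exact: leq_addr.
exact: leq_trans (IH k) (leq_addl _ _).
Qed.

Section RowCard.
Context (n : nat) (nu : seq nat) (nuP : is_part nu) (nun : sumn nu = n) (t : 'S_n).

Lemma tcol_ltn x : (tcol nu t x < n)%N.
Proof.
have h := tcol_lt t nun x; apply: leq_trans h _.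
by rewrite -[X in (_ <= X)%N]nun leq_nth_sumn.
Qed.

Lemma row_card_le p q : (p <= q)%N ->
  (#|[set x | trow nu t x == q]| <= #|[set x | trow nu t x == p]|)%N.
Proof.
move=> pq; apply: (@card_le_match _ _ _ _ (fun x => tcol nu t x) (fun x => tcol nu t x)).
  move=> x y; rewrite !inE => /eqP hx /eqP hy; apply: (tableau_eq nun).
  by rewrite hx hy.
move=> x; rewrite inE => /eqP hx.
have [||y hy cy] := @cell_at n nu t nun p (tcol nu t x).
- by apply: leq_ltn_trans pq _; rewrite -hx trow_lt.
- by apply: leq_trans (tcol_lt t nun x) _; rewrite nth_part // hx.
by exists y => //; rewrite inE hy.
Qed.
End RowCard.

Section Completeness.
Context (F : numClosedFieldType) (n : nat) (V : rep F n) (h : invariant_form V).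
Context (S : V -> Prop) (HS : is_submodule S).

(* The number of pairs of points in a common block, which is to be maximized. *)
Let M (r : {ffun 'I_n -> 'I_n}) := (\sum_x \sum_y (r x == r y))%N.

Let M_split (r : {ffun 'I_n -> 'I_n}) j :
  M r = (1 + (\sum_(y | y != j) (r j == r y)).*2 +
         \sum_(x | x != j) \sum_(y | y != j) (r x == r y))%N.
Proof.
rewrite /M (bigD1 j) //= (bigD1 j) //= eqxx -addnn -!addnA; congr (_ + (_ + _))%N.
rewrite -big_split /=; apply: eq_bigr => x xj.
by rewrite (bigD1 j) //= eq_sym.
Qed.

Let M_update (r : {ffun 'I_n -> 'I_n}) j i0 :
  r i0 != r j -> (#|[set x | r x == r j]| <= #|[set x | r x == r i0]|)%N ->
  (M r < M [ffun x => if x == j then r i0 else r x])%N.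
Proof.
move=> ne le; set r' := finfun _; rewrite !(M_split _ j).
have r'E x : x != j -> r' x = r x by rewrite ffunE => /negbTE->.
have E : (\sum_(x | x != j) \sum_(y | y != j) (r' x == r' y) =
          \sum_(x | x != j) \sum_(y | y != j) (r x == r y))%N.
  by apply: eq_bigr => x xj; apply: eq_bigr => y yj; rewrite !r'E.
rewrite E ltn_add2r ltn_add2l ltn_double.
have card_sum (p : pred 'I_n) : #|[set x | p x]| = (p j + \sum_(y | y != j) p y)%N.
  rewrite -sum1dep_card big_mkcond (bigD1 j) //=; congr (_ + _)%N.
move: le; rewrite !card_sum eqxx eq_sym (negbTE ne) add0n add1n => le.
have -> : (\sum_(y | y != j) (r j == r y) = \sum_(y | y != j) (r y == r j))%N.
  by apply: eq_bigr => y _; rewrite eq_sym.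
have -> //: (\sum_(y | y != j) (r' j == r' y) = \sum_(y | y != j) (r y == r i0))%N.
have r'j : r' j = r i0 by rewrite ffunE eqxx.
by apply: eq_bigr => y yj; rewrite r'j r'E // eq_sym.
Qed.

(** The discrete partition shows that some [r] has a nonzero vector invariant under the
    permutations preserving its blocks.  For a maximal [r] the raising relations hold, because a
    raised vector is invariant for the blocks obtained by moving one point to a block that is at
    least as large, and this increases the number of pairs. *)
Lemma exists_tableau z0 : S z0 -> z0 != 0 -> exists (nu : seq nat) (t : 'S_n) z,
  [/\ is_part nu, sumn nu = n, S z &
      gsum true (col_stab nu t) (gsum false (row_stab nu t) z) != 0].
Proof.
move=> Sz0 z0n.
pose P (r : {ffun 'I_n -> 'I_n}) := `[< exists z, [/\ S z, z != 0 &
  forall s : 'S_n, (forall x, r (s x) = r x) -> rep_act s z = z] >].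
have P0 : P [ffun x => x].
  apply/asboolP; exists z0; split=> // s hs.
  suff -> : s = 1%g by rewrite rep_act1.
  by apply/permP => x; have := hs x; rewrite !ffunE perm1.
case: (arg_maxnP M P0) => r /asboolP[z [Sz zn zinv]] rmax.
have [nu [t [nuP nun tr]]] := tableau_of_fibers r.
have zrow s : s \in row_stab nu t -> rep_act s z = z.
  by move/row_stabP => hs; apply: zinv => x; apply/eqP; rewrite -tr hs.
exists nu, t, z; split=> //.
rewrite gsum_inv // linearZ /= scaler_eq0 pnatr_eq0 negb_or -lt0n cardG_gt0 /=.
apply: (col_gsum_neq0 h) => // p j pj.
have [||i0 ri0 _] := @cell_at n nu t nun p 0%N.
- exact: ltn_trans (trow_lt t nun j).
- apply: leq_trans (nth_part nuP (ltnW pj)).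
  by apply: leq_ltn_trans (leq0n _) (tcol_lt t nun j).
have ri0j : r i0 != r j by rewrite -tr ri0 ltn_eqF.
pose r' := [ffun x => if x == j then r i0 else r x].
have r'E x : x != j -> r' x = r x by rewrite ffunE => /negbTE->.
have r'j : r' j = r i0 by rewrite ffunE eqxx.
pose Q := [set i | r' i == r i0].
have jQ : j \in Q by rewrite inE r'j.
have QE : z + \sum_(i | trow nu t i == p) rep_act (tperm i j) z = coset_sum Q j z.
  rewrite /coset_sum [RHS](bigD1 j) //= tperm1 rep_act1; congr (_ + _).
  apply: eq_bigl => i; rewrite -ri0 tr inE.
  have [->|ij] := eqVneq i j; first by rewrite andbF eq_sym (negbTE ri0j).
  by rewrite andbT r'E.
rewrite QE; apply/eqP; apply/negPn/negP => wn.
have : P r'.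
  apply/asboolP; exists (coset_sum Q j z); split=> //.
    by apply: (submod_sum HS) => i _; apply: (submodA HS).
  move=> s hs.
  apply: (@coset_sum_inv _ _ _ (Group (fiber_group_set r'))) => //.
  - by move=> g x; rewrite !inE => /forallP hg; rewrite (eqP (hg x)).
  - move=> i; rewrite !inE => /eqP hi; apply/forallP => x.
    by case: tpermP => // ->; rewrite r'j hi.
  - move=> g; rewrite inE => /forallP hg gj; apply: zinv => x.
    have [->|xj] := eqVneq x j; first by rewrite gj.
    have gxj : g x != j by rewrite -gj (inj_eq perm_inj).
    by have /eqP := hg x; rewrite !r'E.
  by rewrite inE; apply/forallP => x; rewrite hs.
move/rmax; apply/negP; rewrite -ltnNge; apply: M_update => //.
have fE i : [set x | r x == r i] = [set x | trow nu t x == trow nu t i].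
  by apply/setP => x; rewrite !inE tr.
by rewrite !fE ri0 row_card_le // ltnW.
Qed.

End Completeness.

(** * Dominance *)

Section RowCard.
Context (n : nat) (nu : seq nat) (nun : sumn nu = n) (t : 'S_n).

Lemma row_card k : #|[set x | trow nu t x == k]| = nth 0%N nu k.
Proof.
rewrite cardE -(size_map (fun x => tcol nu t x)) -[RHS](size_iota 0).
apply/perm_size/uniq_perm; rewrite ?iota_uniq //.
  rewrite map_inj_in_uniq ?enum_uniq // => x y; rewrite !mem_enum !inE => /eqP hx /eqP hy.
  by apply: (tableau_eq nun); rewrite hx hy.
move=> c; rewrite mem_iota add0n /=; apply/mapP/idP.
  by move=> -[x + ->]; rewrite mem_enum inE => /eqP <-; apply: tcol_lt.
move=> hc; have [||x hx hx'] := @cell_at n nu t nun k c => //.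
  by rewrite ltnNge; apply: contraTN hc => h; rewrite nth_default.
by exists x; rewrite ?mem_enum ?inE ?hx.
Qed.

Lemma card_lt_sum (r : 'I_n -> nat) i :
  #|[set x | (r x < i)%N]| = (\sum_(k < i) #|[set x | r x == k]|)%N.
Proof.
elim: i => [|i IH]; first by rewrite big_ord0; apply: eq_card0 => x; rewrite inE.
rewrite big_ord_recr /= -IH -cardsUI.
rewrite [X in (_ + X)%N](_ : _ = 0%N) ?addn0; last first.
  by apply: eq_card0 => x; rewrite !inE; case: ltngtP.
by apply: eq_card => x; rewrite !inE ltnS leq_eqVlt orbC.
Qed.

Lemma rows_lt_card i : #|[set x | (trow nu t x < i)%N]| = (\sum_(k < i) nth 0%N nu k)%N.
Proof. by rewrite card_lt_sum; apply: eq_bigr => k _; rewrite row_card. Qed.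

End RowCard.

Lemma part_eq nu nu' : is_part nu -> is_part nu' ->
  (forall k, nth 0%N nu k = nth 0%N nu' k) -> nu = nu'.
Proof.
move=> /andP[_ z] /andP[_ z'] E.
have sz (l l' : seq nat) : (0 \notin l')%N -> (forall k, nth 0%N l k = nth 0%N l' k) ->
    (size l' <= size l)%N.
  move=> z0 e; rewrite leqNgt; apply: contra z0 => h.
  by rewrite -[0%N](_ : nth 0%N l' (size l) = _) ?mem_nth // -e nth_default.
by apply: (@eq_from_nth _ 0%N) => [|i _ //]; apply/eqP; rewrite eqn_leq !sz.
Qed.

Section Transversal.
Context (n : nat) (nu : seq nat) (nuP : is_part nu) (nun : sumn nu = n) (t : 'S_n).
Context (r : 'I_n -> nat).
(* [r] plays the role of the row function of another tableau; the hypothesis is that no two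
   points of one column of [t] have the same value. *)
Hypothesis r_trans : forall x y, r x = r y -> tcol nu t x = tcol nu t y -> x = y.

(** The values of [r] on a column are distinct, whereas the rows met by a column of [t] are the
    lowest possible ones. *)
Lemma transversal_col_le c i :
  (#|[set x | (tcol nu t x == c) && (r x < i)%N]| <=
   #|[set x | (tcol nu t x == c) && (trow nu t x < i)%N]|)%N.
Proof.
have [/existsP[z /andP[/eqP zc zi]]|no] :=
  boolP [exists z, (tcol nu t z == c) && (i <= trow nu t z)%N].
  apply: (@card_le_match _ _ _ _ r (fun x => trow nu t x)) => [x y|x].
    by rewrite !inE => /andP[/eqP hx _] /andP[/eqP hy _] e; apply: r_trans; rewrite // hx.
  rewrite inE => /andP[_ rx]; have rz := leq_trans rx zi.
  have [||y y1 y2] := @cell_at n nu t nun (r x) c.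
  - exact: ltn_trans (trow_lt t nun z).
  - by apply: leq_trans (nth_part nuP (ltnW rz)); rewrite -zc tcol_lt.
  by exists y; rewrite // inE y1 y2 eqxx.
apply: subset_leq_card; apply/subsetP => x; rewrite !inE => /andP[xc _].
rewrite xc; move/existsPn: no => /(_ x); rewrite xc /= -ltnNge //.
Qed.

Lemma col_card_sum (p : pred 'I_n) :
  #|[set x | p x]| = (\sum_(c < n) #|[set x | (tcol nu t x == c) && p x]|)%N.
Proof.
rewrite -sum1dep_card (partition_big (fun x => Ordinal (tcol_ltn nun t x)) xpredT) //=.
by apply: eq_bigr => c _; rewrite -sum1dep_card; apply: eq_bigl => x; rewrite andbC -val_eqE.
Qed.

Lemma transversal_le i :
  (#|[set x | (r x < i)%N]| <= #|[set x | (trow nu t x < i)%N]|)%N.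
Proof.
by rewrite !col_card_sum; apply: leq_sum => c _; apply: transversal_col_le.
Qed.

Hypothesis r_card : forall k, #|[set x | r x == k]| = nth 0%N nu k.

Lemma transversal_col_eq c i :
  #|[set x | (tcol nu t x == c) && (r x < i)%N]| =
  #|[set x | (tcol nu t x == c) && (trow nu t x < i)%N]|.
Proof.
have [cn|nc] := ltnP c n; last first.
  rewrite !(eq_card0 (A := mem (finset _))) // => x; rewrite inE; apply/negbTE;
  by rewrite negb_and neq_ltn (leq_trans (tcol_ltn nun t x) nc).
have := @leqif_sum 'I_n xpredT (fun c => #|[set x | (tcol nu t x == c) && (r x < i)%N]| ==
    #|[set x | (tcol nu t x == c) && (trow nu t x < i)%N]|) 
  (fun c => #|[set x | (tcol nu t x == c) && (r x < i)%N]|)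
  (fun c => #|[set x | (tcol nu t x == c) && (trow nu t x < i)%N]|).
case=> [k _|_]; first by split; first exact: transversal_col_le.
rewrite -!col_card_sum (rows_lt_card nun) card_lt_sum.
under eq_bigr => k _ do rewrite r_card.
by rewrite eqxx => /esym/forallP /(_ (Ordinal cn))/eqP.
Qed.

(** When [r] has as many points of each value as [t] has in each row, the inequalities above are
    equalities, so that each column of [t] contains each value of [r] as often as the
    corresponding row. *)
Lemma transversal_perm : exists2 s, s \in col_stab nu t & forall x, r x = trow nu t (s x).
Proof.
have ex x : exists y, (trow nu t y == r x) && (tcol nu t y == tcol nu t x).
  have cardS (f : 'I_n -> nat) c i : #|[set x | (tcol nu t x == c) && (f x < i.+1)%N]| =
     (#|[set x | (tcol nu t x == c) && (f x < i)%N]| +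
      #|[set x | (tcol nu t x == c) && (f x == i)]|)%N.
    rewrite -cardsUI [X in (_ + X)%N](_ : _ = 0%N) ?addn0; last first.
      by apply: eq_card0 => y; rewrite !inE; case: eqP => //= _; case: ltngtP.
    by apply: eq_card => y; rewrite !inE ltnS leq_eqVlt orbC -andb_orr.
  have := transversal_col_eq (tcol nu t x) (r x).+1.
  rewrite !cardS transversal_col_eq => /addnI.
  case: (set_0Vmem [set y | (tcol nu t y == tcol nu t x) && (trow nu t y == r x)]) => [->|].
    by rewrite cards0 => /cards0_eq/setP/(_ x); rewrite !inE !eqxx.
  by case=> y; rewrite inE => /andP[h1 h2] _; exists y; rewrite h1 h2.
pose f x := xchoose (ex x).
have fP x : trow nu t (f x) = r x /\ tcol nu t (f x) = tcol nu t x.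
  by have /andP[/eqP ? /eqP ?] := xchooseP (ex x).
have f_inj : injective f.
  move=> x y e; apply: r_trans; first by rewrite -(fP x).1 e (fP y).1.
  by rewrite -(fP x).2 e (fP y).2.
exists (perm f_inj); last by move=> x; rewrite permE (fP x).1.
by apply/col_stabP => x; rewrite permE (fP x).2.
Qed.

End Transversal.

(** * Specht modules *)

Section FormFun.
Context (F : numClosedFieldType) (X : finType).
Implicit Types f g : {ffun X -> F^o}.
Definition fdot f g : F := \sum_x f x * (g x)^*.
Lemma fdot_lin a f g k : fdot (a *: f + g) k = a * fdot f k + fdot g k.
Proof.
rewrite /fdot mulr_sumr -big_split; apply: eq_bigr => x _ /=.
by rewrite !ffunE mulrDl mulrA.
Qed.
Lemma fdotC f g : fdot g f = (fdot f g)^*.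
Proof.
rewrite /fdot rmorph_sum; apply: eq_bigr => x _ /=.
by rewrite rmorphM /= conjCK mulrC.
Qed.
Lemma fdot_ge0 f : 0 <= fdot f f.
Proof. by apply: sumr_ge0 => x _; rewrite mul_conjC_ge0. Qed.
Lemma fdot_eq0 f : fdot f f = 0 -> f = 0.
Proof.
move/eqP; rewrite psumr_eq0 => [/allP f0|x _]; last by rewrite mul_conjC_ge0.
apply/ffunP => x; rewrite ffunE; apply/eqP; rewrite -mul_conjC_eq0.
by apply: f0; rewrite mem_index_enum.
Qed.
Lemma fdot_reindex (p : X -> X) f g : injective p ->
  fdot [ffun x => f (p x)] [ffun x => g (p x)] = fdot f g.
Proof.
move=> pinj; rewrite /fdot [RHS](reindex_inj pinj).
by apply: eq_bigr => x _; rewrite !ffunE.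
Qed.
End FormFun.

Section TabloidForm.
Context (F : numClosedFieldType) (n : nat) (nu : seq nat).
Lemma tabloid_act_inj s : injective (@tabloid_act n nu s).
Proof. by move=> T T' e; rewrite -(tabloid_act1 T) -(tabloid_act1 T') -(mulgV s) !tabloid_actM e. Qed.

Definition tabloid_form : invariant_form (tabloid_rep F n nu).
Proof.
exists (@fdot F (tabloid n nu)).
- exact: fdot_lin.
- exact: fdotC.
- exact: fdot_ge0.
- exact: fdot_eq0.
- by move=> s u v; apply: fdot_reindex; apply: tabloid_act_inj.
Defined.

Notation indT t := (indic F (tabloid_of nu t) : tabloid_rep F n nu).

Lemma act_indT (s t : 'S_n) : rep_act s (indT t) = indT (s^-1 * t)%g.
Proof. by rewrite -tabloid_act_of; exact: act_indic. Qed.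

Lemma polytabloidE (t : 'S_n) : polytabloid F nu t = gsum true (col_stab nu t) (indT t).
Proof.
rewrite /polytabloid !gsumE; apply: eq_bigr => s _; congr (_ *: _).
by rewrite /rep_act /= act_indic.
Qed.

Lemma tabloid_of_eq (t t' : 'S_n) : (forall x, trow nu t x = trow nu t' x) ->
  tabloid_of nu t = tabloid_of nu t'.
Proof. by move=> e; apply/ffunP => r; rewrite !ffunE; apply/setP => x; rewrite !inE e. Qed.

(** The vector is fixed by a transposition that changes the sign of the alternating sum. *)
Lemma gsum_sign0 (V : rep F n) (G : {group 'S_n}) x y (v : V) : x != y ->
  tperm x y \in G -> rep_act (tperm x y) v = v -> gsum true G v = 0.
Proof.
move=> xy xyG e; have := gsum_act true v xyG; rewrite e odd_tperm xy /= expr1 scaleN1r.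
move/eqP; rewrite -addr_eq0 -mulr2n -scaler_nat scaler_eq0 pnatr_eq0 /=.
by move/eqP.
Qed.

(** The permutation module M^nu inside the functions on all families of sets. *)
Definition in_tabloids (v : tabloid_rep F n nu) :=
  Defs.span (fun u : tabloid_rep F n nu => exists t : 'S_n, u = indT t) v.

Lemma in_tabloids_submodule : is_submodule in_tabloids.
Proof.
apply: span_submodule => s _ [t ->]; exists 1%N, (fun=> 1), (fun=> indT (s^-1 * t)%g).
by split; [move=> _; eexists | rewrite big_ord1 scale1r act_indT].
Qed.

Lemma specht_tabloids v : Defs.span (@is_polytabloid F n nu) v -> in_tabloids v.
Proof.
case=> m [a [u [hu ->]]]; apply: (submod_sum in_tabloids_submodule) => k _.
apply: (submodZ in_tabloids_submodule); have [t ->] := hu k.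
rewrite polytabloidE; apply: (gsum_submod _ _ in_tabloids_submodule).
by exists 1%N, (fun=> 1), (fun=> indT t); split; [move=> _; exists t | rewrite big_ord1 scale1r].
Qed.

Hypotheses (nuP : is_part nu) (nun : sumn nu = n).

(** Either two points of one row of [g] share a column of [t], and their transposition kills the
    sum, or the two tableaux differ by a column permutation followed by a row permutation. *)
Lemma col_gsum_tabloid (t g : 'S_n) : exists a,
  gsum true (col_stab nu t) (indT g) = a *: polytabloid F nu t.
Proof.
have [/existsP[x /existsP[y /and3P[xy /eqP rxy /eqP cxy]]]|no] :=
  boolP [exists x, exists y, [&& x != y, trow nu g x == trow nu g y & tcol nu t x == tcol nu t y]].
  exists 0; rewrite scale0r.
  apply: (@gsum_sign0 _ (col_stab_group nu t) x y) => //.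
    by apply/col_stabP => z; case: tpermP => // ->.
  rewrite act_indT tpermV; congr (indic F _); apply: tabloid_of_eq => z.
  by rewrite /cell_of permM -!/(cell_of nu g _); case: tpermP => // ->.
have [||s sC sE] := @transversal_perm n nu nuP nun t (fun x => trow nu g x).
- move=> x y hr hc; apply/eqP; apply: contraNT no => xy.
  by apply/existsP; exists x; apply/existsP; exists y; rewrite xy hr hc !eqxx.
- by move=> k; rewrite row_card.
exists ((-1) ^+ s^-1%g); rewrite polytabloidE.
have -> : indT g = rep_act s^-1%g (indT t).
  rewrite act_indT invgK; congr (indic F _); apply: tabloid_of_eq => x.
  by rewrite sE /cell_of permM.
by rewrite (@gsum_act _ _ _ true (col_stab_group nu t)) // groupV.
Qed.

Lemma col_gsum_line (t : 'S_n) v : in_tabloids v -> exists a,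
  gsum true (col_stab nu t) v = a *: polytabloid F nu t.
Proof.
case=> m [a [u [hu ->]]]; rewrite linear_sum /=.
have hk k : exists b, gsum true (col_stab nu t) (a k *: u k) = b *: polytabloid F nu t.
  have [g ->] := hu k; have [b hb] := col_gsum_tabloid t g.
  by exists (a k * b); rewrite linearZ /= hb scalerA.
exists (\sum_k sval (cid (hk k))); rewrite scaler_suml; apply: eq_bigr => k _.
exact: (svalP (cid (hk k))).
Qed.

End TabloidForm.

Notation indT F nu t := (indic F (tabloid_of nu t) : tabloid_rep F _ nu).

Section Shapes.
Context (F : numClosedFieldType) (n : nat) (nu nu' : seq nat).
Hypotheses (nuP : is_part nu) (nun : sumn nu = n).
Hypotheses (nuP' : is_part nu') (nun' : sumn nu' = n).

(** A nonzero value of the column sum of [t] on M^nu' makes nu dominate nu', and a nonzero value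
    of the row sum of [t] on a polytabloid of shape nu' makes nu' dominate nu. *)
Lemma shape_unique (t : 'S_n) (v : tabloid_rep F n nu') : Defs.span (@is_polytabloid F n nu') v ->
  gsum true (col_stab nu t) (gsum false (row_stab nu t) v) != 0 -> nu = nu'.
Proof.
move=> Sv nz; set w := gsum false _ v in nz.
have [g bg] : exists g : 'S_n, gsum true (col_stab nu t) (indT F nu' g) != 0.
  have Tw : in_tabloids w.
    by apply: (gsum_submod _ _ (in_tabloids_submodule F n nu')); apply: specht_tabloids.
  apply: contrapT => no; case: Tw => m [a [u [hu wE]]].
  move/eqP: nz; apply; rewrite wE linear_sum big1 // => k _ /=.
  rewrite linearZ /=; have [g ->] := hu k.
  have [->|nz] := eqVneq (gsum true (col_stab nu t) (indT F nu' g)) 0; first by rewrite scaler0.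
  by case: no; exists g.
have le1 i : (\sum_(k < i) nth 0%N nu' k <= \sum_(k < i) nth 0%N nu k)%N.
  rewrite -(rows_lt_card nun' g) -(rows_lt_card nun t).
  apply: transversal_le => // x y hr hc; apply/eqP; apply: contraNT bg => xy; apply/eqP.
  apply: (@gsum_sign0 _ _ _ (col_stab_group nu t) x y) => //.
    by apply/col_stabP => z; case: tpermP => // ->.
  rewrite act_indT tpermV; congr (indic F _); apply: tabloid_of_eq => z.
  by rewrite /cell_of permM -!/(cell_of nu' g _); case: tpermP => // ->.
have w_neq0 : w != 0 by apply: contraNneq nz => ->; rewrite linear0.
have [g' ag'] : exists g : 'S_n, gsum false (row_stab nu t) (polytabloid F nu' g) != 0.
  apply: contrapT => no; case: Sv => m [a [u [hu vE]]].
  move/eqP: w_neq0; apply; rewrite /w vE linear_sum big1 // => k _ /=.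
  rewrite linearZ /=; have [g' ->] := hu k.
  have [->|nz'] := eqVneq (gsum false (row_stab nu t) (polytabloid F nu' g')) 0.
    by rewrite scaler0.
  by case: no; exists g'.
have le2 i : (\sum_(k < i) nth 0%N nu k <= \sum_(k < i) nth 0%N nu' k)%N.
  rewrite -(rows_lt_card nun' g') -(rows_lt_card nun t).
  apply: transversal_le => // x y hr hc; apply/eqP; apply: contraNT ag' => xy; apply/eqP.
  have xyC : tperm x y \in col_stab_group nu' g'.
    by apply/col_stabP => z; case: tpermP => // ->.
  have xyR : tperm x y \in row_stab_group nu t.
    by apply/row_stabP => z; case: tpermP => // ->.
  rewrite polytabloidE; set b := gsum true _ _.
  have E := gsum_act false b xyR; move: E; rewrite andFb expr0 scale1r {1}/b.
  rewrite (act_gsum true _ xyC) odd_tperm xy andbT expr1 scaleN1r linearN => /esym/eqP.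
  rewrite -addr_eq0 -mulr2n -scaler_nat scaler_eq0 pnatr_eq0 /=.
  by move/eqP.
apply: part_eq => // k.
have E i : (\sum_(k < i) nth 0%N nu k = \sum_(k < i) nth 0%N nu' k)%N.
  by apply/eqP; rewrite eqn_leq le1 le2.
by have := E k.+1; rewrite !big_ord_recr /= E => /addnI.
Qed.

End Shapes.

Lemma tableau_change n (t t' : 'S_n) : exists s : 'S_n, t' = (s^-1 * t)%g.
Proof. by exists (t * t'^-1)%g; rewrite invMg invgK -mulgA mulVg mulg1. Qed.

Section SpechtSimple.
Context (F : numClosedFieldType) (n : nat) (nu : seq nat).
Hypotheses (nuP : is_part nu) (nun : sumn nu = n).

(** The submodule generated by [v] consists of elements of the Specht module of nu, so the tableau
    that it must have by [exists_tableau] is of shape nu, and may be replaced by [t]. *)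
Lemma specht_detect (t : 'S_n) (v : tabloid_rep F n nu) : Defs.span (@is_polytabloid F n nu) v ->
  (forall g, gsum true (col_stab nu t) (gsum false (row_stab nu t) (rep_act g v)) = 0) ->
  v = 0.
Proof.
move=> Sv v0; apply: contrapT => /eqP vn.
pose Z := Defs.span (fun u : tabloid_rep F n nu => exists g : 'S_n, u = rep_act g v).
have HZ : is_submodule Z.
  apply: span_submodule => s _ [g ->]; exists 1%N, (fun=> 1), (fun=> rep_act (g * s)%g v).
  by split; [move=> _; eexists | rewrite big_ord1 scale1r rep_actM].
have Zv : Z v.
  exists 1%N, (fun=> 1), (fun=> v); rewrite big_ord1 scale1r; split=> // _.
  by exists 1%g; rewrite rep_act1.
have [nu' [t' [z [nuP' nun' Zz nz]]]] := exists_tableau (tabloid_form F n nu) HZ Zv vn.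
have Sz : Defs.span (@is_polytabloid F n nu) z.
  have HSp := @specht_submodule F n nu.
  case: Zz => m [a [u [hu ->]]].
  apply: (submod_sum HSp) => k _.
  apply: (submodZ HSp); have [g ->] := hu k.
  exact: (submodA HSp).
have E := shape_unique nuP' nun' nuP nun Sz nz; subst nu'.
have [s ts] := tableau_change t' t.
have zZ := submodA HZ s Zz.
have nz' : gsum true (col_stab nu t) (gsum false (row_stab nu t) (rep_act s z)) != 0.
  rewrite ts row_gsum_conj col_gsum_conj.
  apply: contra nz => /eqP e; apply/eqP.
  by rewrite -[LHS](rep_act1) -(mulgV s) rep_actM e linear0.
case: zZ => m [a [u [hu e]]].
move/eqP: nz'; apply; rewrite e !gsum_sum; apply: big1 => k _.
by rewrite !gsumZ; have [g ->] := hu k; rewrite v0 scaler0.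
Qed.

End SpechtSimple.

(** * Padded partitions *)

Lemma part_head nu : is_part nu -> is_part (behead nu).
Proof.
case: nu => //= a nu /andP[so]; rewrite inE negb_or => /andP[_ z].
by rewrite /is_part z (path_sorted so).
Qed.

Section Pad.
Context (lam : intpart) (n : nat) (ld : pad_defined lam n).
Let l := parts lam.
Let lP : is_part l := valP lam.

Lemma pad_le : (sumn l <= n)%N.
Proof. exact: leq_trans (leq_addr _ _) ld. Qed.

Lemma pad_eq : (sumn l < n)%N -> pad lam n = (n - sumn l)%N :: l.
Proof.
move=> lt; rewrite /pad /= -lt0n subn_gt0 lt; congr (_ :: _); apply/all_filterP/allP => p pl.
by apply: contraTneq pl => ->; case/andP: lP.
Qed.

Lemma pad_lt : (0 < n)%N -> (sumn l < n)%N.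
Proof.
move=> n0; have := ld; rewrite /pad_defined -/l.
have := lP; case: l => [|a l'] //= /andP[_]; rewrite inE negb_or => /andP[a0 _] d.
by apply: leq_trans d; rewrite -addn1 leq_add2l lt0n eq_sym.
Qed.

Lemma pad_part : is_part (pad lam n).
Proof.
have [n0|n0] := posnP n.
  have : is_part l := lP; have := pad_le; rewrite /pad -/l n0 leqn0 sub0n.
  by case: l => [|a l'] //=; rewrite addn_eq0 => /andP[/eqP-> _] /andP[_]; rewrite inE.
rewrite (pad_eq (pad_lt n0)) /is_part /= inE negb_or; have /andP[so ->] := lP.
rewrite andbT eq_sym -lt0n subn_gt0 (pad_lt n0) andbT.
have := ld; have := so; rewrite /pad_defined -/l; case: l => //= a l' -> h; rewrite andbT.
by rewrite -(leq_add2l (a + sumn l')) subnKC // (leq_trans (leq_addr _ _) h).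
Qed.

Lemma pad_sumn : sumn (pad lam n) = n.
Proof.
have [n0|n0] := posnP n; last by rewrite (pad_eq (pad_lt n0)) /= subnK ?pad_le.
have : is_part l := lP; have := pad_le; rewrite /pad -/l n0 leqn0 sub0n.
by case: l => [|a l'] //=; rewrite addn_eq0 => /andP[/eqP-> _] /andP[_]; rewrite inE.
Qed.

End Pad.

Lemma pad_nth0 lam n : pad_defined lam n -> nth 0%N (pad lam n) 0 = (n - sumn (parts lam))%N.
Proof.
move=> ld; have [n0|n0] := posnP n; last by rewrite pad_eq // pad_lt.
have := pad_sumn ld; rewrite n0 sub0n; case: (pad _ _) => //= a l /eqP.
by rewrite addn_eq0 => /andP[/eqP].
Qed.

Lemma pad_inj lam mu n : pad_defined lam n -> pad_defined mu n -> pad lam n = pad mu n -> lam = mu.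
Proof.
move=> ld md E; have [n0|n0] := posnP n; last first.
  by move: E; rewrite !pad_eq ?pad_lt // => -[_ /val_inj].
have nil (nu : intpart) : pad_defined nu n -> val nu = [::].
  move=> d; have : is_part (val nu) := valP nu.
  have := pad_le d; rewrite n0 leqn0 /parts.
  by case: (val nu) => [|a l'] //=; rewrite addn_eq0 => /andP[/eqP-> _] /andP[_]; rewrite inE.
by apply: val_inj; rewrite !nil.
Qed.

Lemma pad_surj nu n : is_part nu -> sumn nu = n ->
  exists lam : intpart, pad_defined lam n /\ pad lam n = nu.
Proof.
move=> nuP nun.
have ld : (sumn (behead nu) + head 0 (behead nu) <= n)%N.
  rewrite -nun; move: nuP; case: nu {nun} => //= a l /andP[/= so _].
  by rewrite addnC leq_add2r; case: l so => //= b l /andP[].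
have nil : (n = 0)%N -> nu = [::].
  move=> n0; move: nuP nun; rewrite n0; case: nu {ld} => //= a l /andP[_] + /eqP.
  rewrite inE negb_or addn_eq0 => /andP[/negbTE h _] /andP[/eqP].
  by move=> e; rewrite e eqxx in h.
have cons : (0 < n)%N -> (n - sumn (behead nu))%N :: behead nu = nu.
  by move: nun; case: nu {nuP ld nil} => /= [<- //|a l <- _]; rewrite addnK.
exists (exist _ (behead nu) (part_head nuP)); split=> //.
have [n0|n0] := posnP n; last by rewrite pad_eq ?pad_lt //= cons.
by rewrite /pad /parts /= nil //= n0.
Qed.

Lemma intpart_finite d : exists s : seq intpart, uniq s /\
  forall lam, (sumn (parts lam) <= d)%N -> lam \in s.
Proof.
pose s0 := pmap (insub : seq nat -> option intpart)
   [seq map val (tval t) | m <- iota 0 d.+1, t <- enum {: m.-tuple 'I_d.+1}].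
exists (undup s0); split=> [|lam le]; first exact: undup_uniq.
rewrite mem_undup mem_pmap; apply/mapP; exists (val lam); last by rewrite valK.
have lP : is_part (val lam) := valP lam.
have sz : (size (val lam) <= d)%N.
  apply: leq_trans _ le; rewrite /parts; case/andP: lP => _.
  elim: (val lam) => //= a l IH; rewrite inE negb_or => /andP[a0 /IH h].
  by rewrite -add1n leq_add // lt0n eq_sym.
apply/allpairsPdep; exists (size (val lam)).
exists [tuple inord (nth 0%N (val lam) i) | i < size (val lam)].
rewrite mem_iota add0n ltnS sz mem_enum; split=> //.
apply: (@eq_from_nth _ 0%N) => [|i ilt]; first by rewrite size_map size_tuple.
rewrite (nth_map ord0) ?size_tuple //.
have /= -> := nth_mktuple
  (fun k : 'I_(size (val lam)) => inord (nth 0%N (val lam) k) : 'I_d.+1) ord0 (Ordinal ilt).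
rewrite inordK // ltnS; apply: leq_trans _ le; exact: leq_nth_sumn.
Qed.

(** * Word modules *)

Section Words.
Context (F : fieldType) (A : finType) (n : nat).

Definition word := {ffun 'I_n -> A}.
Definition word_perm (w : word) (s : 'S_n) : word := [ffun x => w (s x)].
Definition word_fun := {ffun word -> F^o}.
Definition word_act (s : 'S_n) (f : word_fun) : word_fun := [ffun w => f (word_perm w s)].
Fact word_act_linear s : linear (word_act s).
Proof. by move=> a f g; apply/ffunP => w; rewrite !ffunE. Qed.
Fact word_act1 f : word_act 1%g f = f.
Proof.
apply/ffunP => w; rewrite ffunE; congr (f _).
by apply/ffunP => x; rewrite ffunE perm1.
Qed.
Fact word_actM s t f : word_act (t * s)%g f = word_act s (word_act t f).
Proof.
apply/ffunP => w; rewrite !ffunE; congr (f _).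
by apply/ffunP => x; rewrite !ffunE permM.
Qed.
Definition word_rep : rep F n := Rep word_act_linear word_act1 word_actM.

Lemma word_permE w s x : word_perm w s x = w (s x).
Proof. exact: ffunE. Qed.

Lemma word_repE s (f : word_rep) w : (rep_act s f : word_fun) w = (f : word_fun) (word_perm w s).
Proof. exact: ffunE. Qed.

Lemma word_perm_inj s : injective (word_perm^~ s).
Proof.
move=> w w' /ffunP e; apply/ffunP => x; have := e (s^-1%g x).
by rewrite !ffunE permKV.
Qed.

End Words.

Definition word_form (F : numClosedFieldType) A n : invariant_form (word_rep F A n).
Proof.
exists (@fdot F (word A n)).
- exact: fdot_lin.
- exact: fdotC.
- exact: fdot_ge0.
- exact: fdot_eq0.
- by move=> s u v; apply: fdot_reindex; apply: word_perm_inj.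
Defined.

(** A subspace of maximal dimension contained in [S] is all of [S]. *)
Lemma subspace_vspace (K : fieldType) (W : vectType K) (S : W -> Prop) : S 0 ->
  (forall a u v, S u -> S v -> S (a *: u + v)) ->
  exists U : {vspace W}, forall v, (v \in U) <-> S v.
Proof.
move=> S0 SD.
pose P m := `[< exists U : {vspace W}, \dim U = m /\ forall v, v \in U -> S v >].
have P0 : exists m, P m.
  exists 0%N; apply/asboolP; exists 0%VS; rewrite dimv0; split=> // v.
  by rewrite memv0 => /eqP->.
have Pb m : P m -> (m <= \dim {:W})%N.
  by move=> /asboolP[U [<- _]]; apply: dimvS; apply: subvf.
case: (ex_maxnP P0 Pb) => m /asboolP[U [dU US]] mmax.
exists U => v; split=> [/US//|Sv]; apply: contrapT => vU.
have : P (\dim (U + <[v]>)).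
  apply/asboolP; exists (U + <[v]>)%VS; split=> // _ /memv_addP[u uU [_ /vlineP[k ->] ->]].
  by rewrite addrC; apply: SD => //; apply: US.
move/mmax; rewrite -dU; apply/negP; rewrite -ltnNge.
rewrite (ltn_leqif (dimv_leqif_sup (addvSl U _))) subv_add subvv /= -memvE.
exact/negP.
Qed.

Section IsoOfImage.
Context (F : fieldType) (n : nat) (V W : rep F n) (S : V -> Prop) (HS : is_submodule S).
Context (f : W -> V) (f_lin : linear f) (f_inj : injective f).
Hypothesis f_act : forall s w, f (rep_act s w) = rep_act s (f w).
Hypothesis f_image : forall v, S v <-> exists w, f w = v.

Lemma iso_of_image : rep_iso (subrep HS) W /\ rep_iso W (subrep HS).
Proof.
have ex (u : subrep HS) : exists w, f w = subrep_val u.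
  by apply/f_image/asboolP; exact: (valP (u : sub_sort HS)).
pose g (u : subrep HS) : W := sval (cid (ex u)).
have gP u : f (g u) = subrep_val u := svalP (cid (ex u)).
have fS w : f w \in sub_pred S by apply/asboolP/f_image; exists w.
pose f' (w : W) : subrep HS := exist (fun u => u \in sub_pred S) (f w) (fS w).
have f'_val w : subrep_val (f' w) = f w by [].
have val_injS (u v : subrep HS) : subrep_val u = subrep_val v -> u = v.
  by move=> e; apply: (@val_inj _ _ (sub_sort HS)).
have g_lin : linear g.
  by move=> a u v; apply: f_inj; rewrite gP f_lin !gP.
have f'_lin : linear f' by move=> a u v; apply: val_injS; rewrite f'_val f_lin.
have gK : cancel g f' by move=> u; apply: val_injS; rewrite f'_val gP.
have fK : cancel f' g by move=> w; apply: f_inj; rewrite gP.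
split.
  pose mg := GRing.isLinear.Build F (subrep HS) W _ g g_lin.
  exists (HB.pack_for {linear subrep HS -> W} g mg); split; first by exists f'.
  by move=> s v; apply: f_inj; rewrite /= f_act !gP.
pose mf := GRing.isLinear.Build F W (subrep HS) _ f' f'_lin.
exists (HB.pack_for {linear W -> subrep HS} f' mf); split; first by exists g.
by move=> s w; apply: val_injS; rewrite /= f'_val f_act.
Qed.
End IsoOfImage.

Lemma rep_iso_trans (F : fieldType) n (U V W : rep F n) :
  rep_iso U V -> rep_iso V W -> rep_iso U W.
Proof.
move=> [f [bf fa]] [g [bg ga]]; exists (g \o f); split; first exact: bij_comp.
by move=> s v /=; rewrite fa ga.
Qed.

(** Being orthogonal to [Im] is a system of [\dim Im] linear equations, fewer than the dimension
    of [S]. *)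
Lemma orth_complement (F : numClosedFieldType) A n (h := word_form F A n)
    (S Im : word_rep F A n -> Prop) :
  is_submodule S -> is_submodule Im -> (forall v, Im v -> S v) ->
  forall v0, S v0 -> ~ Im v0 ->
  exists z, [/\ S z, z != 0 & forall u, Im u -> h z u = 0].
Proof.
move=> HS HI IS v0 Sv0 Iv0.
have [US USP] : exists U : {vspace word_fun F A n}, forall v, (v \in U) <-> S v.
  by case: HS => S0 SD _; apply: subspace_vspace.
have [UI UIP] : exists U : {vspace word_fun F A n}, forall v, (v \in U) <-> Im v.
  by case: HI => S0 SD _; apply: subspace_vspace.
pose m := \dim UI.
pose psi (v : word_fun F A n) : 'rV[F]_m := \row_k h v (vbasis UI)`_k.
have psi_lin : linear psi.
  by move=> a u v; apply/rowP => k; rewrite !mxE dot_lin.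
pose mpsi := GRing.isLinear.Build F (word_fun F A n) 'rV[F]_m _ psi psi_lin.
pose Psi := linfun (HB.pack_for {linear word_fun F A n -> 'rV[F]_m} psi mpsi).
have PsiE v : Psi v = psi v by rewrite lfunE.
have ltd : (m < \dim US)%N.
  rewrite /m ltn_neqAle dimvS ?andbT; last by apply/subvP => v /UIP/IS/USP.
  apply: contra_notN Iv0 => e; apply/UIP.
  suff -> : UI = US by apply/USP.
  by apply/eqP; rewrite eqEdim (eqP e) leqnn andbT; apply/subvP => v /UIP/IS/USP.
have pos : (0 < \dim (US :&: lker Psi))%N.
  rewrite -(ltn_add2r (\dim (Psi @: US))) add0n limg_ker_dim.
  apply: leq_ltn_trans ltd; apply: leq_trans (dimvS (subvf _)) _.
  by rewrite dimvf /dim /= mul1n.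
have nz : (US :&: lker Psi)%VS != 0%VS by rewrite -dimv_eq0 -lt0n.
exists (vpick (US :&: lker Psi)); have := memv_pick (US :&: lker Psi).
rewrite memv_cap => /andP[/USP zS]; rewrite memv_ker PsiE => /eqP z0.
split=> //; first by rewrite vpick0.
move=> u /UIP uU; rewrite (coord_vbasis uU) dot_sumr big1 // => k _.
rewrite dotZr; have /rowP/(_ k) := z0; rewrite !mxE => ->.
by rewrite mulr0.
Qed.

Lemma orth_submodule (F : numClosedFieldType) n (V : rep F n) (h : invariant_form V)
    (S Im : V -> Prop) : is_submodule S -> is_submodule Im ->
  is_submodule (fun w => S w /\ forall u, Im u -> h w u = 0).
Proof.
move=> HS HI; split=> [|c w w' [Sw w0] [Sw' w0']|s w [Sw w0]]; split.
- exact: submod0 HS.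
- by move=> u _; rewrite dot0l.
- by apply: (submodD HS) => //; apply: (submodZ HS).
- by move=> u Iu; rewrite dot_lin w0 // w0' // mulr0 addr0.
- exact: submodA HS _ _ Sw.
move=> u Iu; rewrite -[u]rep_act1 -(mulVg s) rep_actM dot_act; apply: w0.
exact: (submodA HI).
Qed.

(** * Maps out of permutation modules *)

Lemma tabloid_of_rows n nu (t t' : 'S_n) : sumn nu = n ->
  tabloid_of nu t = tabloid_of nu t' -> forall x, trow nu t x = trow nu t' x.
Proof.
move=> nun /ffunP e x; have := e (Ordinal (trow_lt t' nun x)).
by rewrite !ffunE => /setP/(_ x); rewrite !inE /= eqxx => /eqP.
Qed.

Section TabloidMap.
Context (F : numClosedFieldType) (n : nat) (nu : seq nat) (nun : sumn nu = n) (t : 'S_n).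
Context (V : rep F n).
Implicit Types (h : V) (f : {ffun tabloid n nu -> F^o}).

(** For [h] invariant under the row stabilizer of [t], this extends the equivariant map sending the
    tabloid of [t] to [h]; summing over permutations instead of tabloids counts each tabloid once
    per row permutation, and needs no choice of representatives. *)
Definition tabloid_map h f : V :=
  (#|row_stab nu t|%:R)^-1 *: \sum_g f (tabloid_act g (tabloid_of nu t)) *: rep_act g h.

Lemma tabloid_map_linear h : linear (tabloid_map h : tabloid_rep F n nu -> V).
Proof.
move=> a u v; rewrite /tabloid_map scalerA mulrC -scalerA -scalerDr; congr (_ *: _).
rewrite scaler_sumr -big_split; apply: eq_bigr => g _ /=.
by rewrite !ffunE scalerDl scalerA.
Qed.

Lemma tabloid_map_act h s (f : tabloid_rep F n nu) :
  tabloid_map h (rep_act s f) = rep_act s (tabloid_map h f).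
Proof.
rewrite /tabloid_map [RHS]linearZ /= [X in _ = _ *: X]linear_sum; congr (_ *: _).
rewrite [LHS](reindex_inj (mulIg s)); apply: eq_bigr => g _ /=.
rewrite linearZ /= -rep_actM; congr (_ *: _).
by rewrite /rep_act /= ffunE -tabloid_actM -mulgA mulgV mulg1.
Qed.

Lemma tabloid_map_gen h : (forall s, s \in row_stab nu t -> rep_act s h = h) ->
  tabloid_map h (indT F nu t) = h.
Proof.
move=> hinv; rewrite /tabloid_map (bigID (fun g : 'S_n => g \in row_stab nu t)) /=.
rewrite [X in _ + X]big1 => [|g gR]; last first.
  rewrite ffunE tabloid_act_of (_ : _ == _ = false) ?scale0r //.
  apply: contraNF gR => /eqP e; apply/row_stabP => x.
  by rewrite -(tabloid_of_rows nun e) cell_conj.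
rewrite addr0 (eq_bigr (fun=> h)) => [|g gR]; last first.
  rewrite ffunE tabloid_act_of (_ : _ == _ = true) ?scale1r ?hinv //.
  apply/eqP/tabloid_of_eq => x; rewrite -{1}(permKV g x) cell_conj.
  by apply/row_stabP; rewrite groupV.
rewrite sumr_const -[X in _ *: X]scaler_nat scalerA mulVf ?scale1r //.
by rewrite pnatr_eq0 -lt0n cardG_gt0.
Qed.

Lemma tabloid_map_poly h : (forall s, s \in row_stab nu t -> rep_act s h = h) ->
  tabloid_map h (polytabloid F nu t) = gsum true (col_stab nu t) h.
Proof.
move=> hinv; rewrite polytabloidE.
rewrite (@gsum_morph F n (tabloid_rep F n nu) V (tabloid_map h)) ?tabloid_map_gen //.
  exact: tabloid_map_linear.
exact: tabloid_map_act.
Qed.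

Lemma tabloid_map_sub (S : V -> Prop) h f : is_submodule S -> S h -> S (tabloid_map h f).
Proof.
move=> HS Sh; apply: (submodZ HS); apply: (submod_sum HS) => g _.
by apply: (submodZ HS); apply: (submodA HS).
Qed.
End TabloidMap.

Section YoungOps.
Context (F : numClosedFieldType) (n : nat) (V : rep F n) (h : invariant_form V).
Context (nu : seq nat) (t : 'S_n).
Notation a v := (gsum (V:=V) false (row_stab nu t) v).
Notation b v := (gsum (V:=V) true (col_stab nu t) v).

Lemma row_gsum_inv v s : s \in row_stab nu t -> rep_act s (a v) = a v.
Proof.
by move=> sR; rewrite (@act_gsum _ _ _ false (row_stab_group nu t)) // andFb expr0 scale1r.
Qed.

(** For a self-adjoint [a] proportional to a projection, [<b a b y, y> = <a b y, b y>] is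
    proportional to the square of the norm of [a b y]. *)
Lemma young_inj y : b (a (b y)) = 0 -> a (b y) = 0.
Proof.
move=> e; apply/eqP/negPn/negP => nz.
have := @dot_gsum_neq0 _ _ _ h false (row_stab_group nu t) (b y) nz.
by rewrite -(@dot_gsum _ _ _ h true (col_stab_group nu t)) e dot0l eqxx.
Qed.

Lemma young_double z : b (a z) != 0 -> b (a (b (a z))) != 0.
Proof.
move=> nz; apply/negP => /eqP/young_inj e.
have := @dot_gsum_neq0 _ _ _ h true (col_stab_group nu t) (a z) nz.
by rewrite -(@dot_gsum _ _ _ h false (row_stab_group nu t)) e dot0l eqxx.
Qed.
End YoungOps.

(** * Decomposition into Specht modules *)

Lemma free_seq_eq0 (K : fieldType) (U : vectType K) (X : seq U) m (c : 'I_m -> K) :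
  free X -> size X = m -> \sum_k c k *: X`_k = 0 -> forall k, c k = 0.
Proof. by move=> fX e; subst m; move: (fX : free (in_tuple X)) => /freeP h /h. Qed.

Section Decomposition.
Context (F : numClosedFieldType) (A : finType) (n : nat).
Notation V := (word_rep F A n).
Context (S : V -> Prop) (HS : is_submodule S) (T : intpart -> 'S_n).
Let h := word_form F A n.

Notation a lam v := (gsum (V:=V) false (row_stab (pad lam n) (T lam)) v).
Notation b lam v := (gsum (V:=V) true (col_stab (pad lam n) (T lam)) v).

(** The image of the row sum times the column sum.  Equivariant maps from the Specht module of
    [pad lam n] to [S] correspond to its vectors, see [Phi] below. *)
Definition mult_vector (lam : intpart) (v : V) : Prop := exists2 z, S z & v = a lam (b lam z).

Lemma mult_vector0 lam : mult_vector lam 0.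
Proof. by exists 0; rewrite ?gsum0 //; apply: (submod0 HS). Qed.
Lemma mult_vectorD lam c u v : mult_vector lam u -> mult_vector lam v -> mult_vector lam (c *: u + v).
Proof.
move=> [y Sy ->] [z Sz ->]; exists (c *: y + z); last by rewrite !linearP.
by apply: (submodD HS) => //; apply: (submodZ HS).
Qed.

Definition mult_space lam : {vspace word_fun F A n} :=
  sval (cid (subspace_vspace (mult_vector0 lam) (@mult_vectorD lam))).
Lemma mult_spaceP lam v : (v \in mult_space lam) <-> mult_vector lam v.
Proof. exact: (svalP (cid (subspace_vspace (mult_vector0 lam) (@mult_vectorD lam)))). Qed.

Definition mult lam : nat := if pad_defined lam n then \dim (mult_space lam) else 0%N.

Lemma mult_vector_sub lam v : mult_vector lam v -> S v.
Proof. by move=> [z Sz ->]; do 2 apply: (gsum_submod _ _ HS). Qed.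

Lemma mult_vector_row lam v s : mult_vector lam v -> s \in row_stab (pad lam n) (T lam) ->
  rep_act s v = v.
Proof. by move=> [z Sz ->]; apply: row_gsum_inv. Qed.

Lemma mult_vector_col_inj lam v : mult_vector lam v -> b lam v = 0 -> v = 0.
Proof. by move=> [z Sz ->]; apply: (young_inj h). Qed.

(** From [b a z <> 0] it follows that [a b a z] is a vector as desired, by [young_double]. *)
Lemma mult_vector_exists (Z : V -> Prop) z0 : is_submodule Z -> Z z0 -> z0 != 0 ->
  (forall v, Z v -> S v) -> exists lam v,
  [/\ pad_defined lam n, mult_vector lam v, Z v & b lam v != 0].
Proof.
move=> HZ Zz0 nz0 ZS; have [nu [t [z [nuP nun Zz nz]]]] := exists_tableau h HZ Zz0 nz0.
have [lam [ld E]] := pad_surj nuP nun; subst nu.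
have [s Es] := tableau_change t (T lam).
have nz' : b lam (a lam (rep_act s z)) != 0.
  rewrite Es row_gsum_conj col_gsum_conj; apply: contra nz => /eqP e; apply/eqP.
  by rewrite -[LHS](rep_act1) -(mulgV s) rep_actM e linear0.
have Zs := submodA HZ s Zz.
exists lam, (a lam (b lam (a lam (rep_act s z)))); split=> //.
- exists (a lam (rep_act s z)) => //.
  by apply: (gsum_submod _ _ HS); apply: ZS.
- by do 3 apply: (gsum_submod _ _ HZ).
exact: (young_double h).
Qed.

(** By complete reducibility, the orthogonal complement of a proper submodule has a nonzero Young
    operator.  Both the surjectivity of the decomposition map and the generation of a term of a
    chain by the previous one are proved by contradicting this. *)
Lemma mult_vector_orthogonal (Im : V -> Prop) v0 : is_submodule Im -> (forall u, Im u -> S u) ->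
  S v0 -> ~ Im v0 -> exists lam v,
  [/\ pad_defined lam n, mult_vector lam v, forall u, Im u -> h v u = 0 & b lam v != 0].
Proof.
move=> HI IS Sv0 nI; have [z [Sz nz zI]] := orth_complement HS HI IS Sv0 nI.
have [lam [v [ld hv [_ vI] bv]]] := mult_vector_exists (orth_submodule h HS HI) (conj Sz zI) nz
  (fun w Zw => proj1 Zw).
by exists lam, v.
Qed.

Notation I := {lam : intpart & 'I_(mult lam)}.
Notation W i := (specht F n (pad (tag i) n)).
Notation D := (dsum (fun i : I => W i)).

Let mv (i : I) : V := (vbasis (mult_space (tag i)))`_(tagged i).

Let multE lam : pad_defined lam n -> mult lam = \dim (mult_space lam).
Proof. by rewrite /mult => ->. Qed.

Let pad_tag (i : I) : pad_defined (tag i) n.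
Proof. by case: i => lam [k] /=; rewrite /mult; case: ifP. Qed.

Let mvP i : mult_vector (tag i) (mv i).
Proof.
apply/mult_spaceP/vbasis_mem/mem_nth; rewrite size_tuple -multE ?ltn_ord //.
Qed.

Let phi (i : I) (f : tabloid_rep F n (pad (tag i) n)) : V :=
  tabloid_map (T (tag i)) (mv i) f.

Let phi_linear i : linear (@phi i). Proof. exact: tabloid_map_linear. Qed.
Let phi_act i s f : phi (rep_act s f) = rep_act s (@phi i f).
Proof. exact: tabloid_map_act. Qed.

Let idx_ex : exists s : seq I, uniq s /\ forall i, i \in s.
Proof.
have [s [su sP]] := intpart_finite n.
exists [seq Tagged (fun lam => 'I_(mult lam)) k | lam <- s, k <- enum 'I_(mult lam)]; split.
  apply: allpairs_uniq_dep => // [lam _|[x y] [x' y'] _ _ /= e]; first exact: enum_uniq.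
  exact: e.
move=> [lam k]; apply/allpairsPdep; exists lam, k; rewrite mem_enum; split=> //.
by apply: sP; apply: (@pad_le lam n); apply: (pad_tag (existT _ lam k)).
Qed.

Let idx := sval (cid idx_ex).
Let idx_uniq : uniq idx := (svalP (cid idx_ex)).1.
Let mem_idx i : i \in idx := (svalP (cid idx_ex)).2 i.

Let comp (v : D) (i : I) : tabloid_rep F n (pad (tag i) n) :=
  subrep_val ((subrep_val v : dprod_sort (fun i : I => W i)) i).

(* Each basis vector of a multiplicity space contributes one copy of a Specht module. *)
Let Phi (v : D) : V := \sum_(i <- idx) phi (comp v i).

Let comp_linear i c u v : comp (c *: u + v) i = c *: comp u i + comp v i.
Proof. by []. Qed.

Let comp_act i s v : comp (rep_act s v) i = rep_act s (comp v i).
Proof. by []. Qed.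

Let Phi_linear : linear Phi.
Proof.
move=> c u v; rewrite /Phi scaler_sumr -big_split; apply: eq_bigr => i _.
by rewrite comp_linear phi_linear.
Qed.

Let Phi_act s v : Phi (rep_act s v) = rep_act s (Phi v).
Proof.
rewrite /Phi linear_sum; apply: eq_bigr => i _ /=.
by rewrite comp_act phi_act.
Qed.

Let comp_specht v i : Defs.span (@is_polytabloid F n (pad (tag i) n)) (comp v i).
Proof. by apply/asboolP; exact: (valP ((subrep_val v : dprod_sort (fun i : I => W i)) i : sub_sort _)). Qed.

Let Phi_sub v : S (Phi v).
Proof.
apply: (submod_sum HS) => i _; apply: tabloid_map_sub => //.
exact: mult_vector_sub (mvP i).
Qed.

Let comp0 v : (forall i, comp v i = 0) -> v = 0.
Proof.
move=> v0; apply: (@val_inj _ _ (sub_sort _)).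
apply: functional_extensionality_dep => i.
by apply: (@val_inj _ _ (sub_sort _)); exact: v0.
Qed.

Let phi_gsum i e G f : phi (gsum e G f) = gsum e G (@phi i f).
Proof.
by apply: gsum_morph => [|s v]; [exact: phi_linear | exact: phi_act].
Qed.

Let phiZ i c f : phi (c *: f) = c *: @phi i f.
Proof. exact: linear_funZ (@phi_linear i) c f. Qed.

Let phi0 i : @phi i 0 = 0.
Proof. exact: linear_fun0 (@phi_linear i). Qed.

(* Applied to a relation, the Young operator of [lam] annihilates the components of the other
   shapes and turns each component of shape [lam] into a multiple [c k] of the polytabloid of
   [T lam].  The relation becomes a linear dependence between basis vectors of the multiplicity
   space, on which the column sum is injective; so the [c k] vanish, for every translate of the
   relation, and [specht_detect] applies. *)
Let Phi_inj : injective Phi.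
Proof.
suff ker0 v : Phi v = 0 -> v = 0.
  move=> u v e; apply/eqP; rewrite -subr_eq0; apply/eqP/ker0.
  by rewrite addrC -scaleN1r Phi_linear e scaleN1r addNr.
move=> v0; apply: comp0 => -[lam k0].
have ld : pad_defined lam n := pad_tag (existT _ lam k0).
apply: (@specht_detect F n (pad lam n) (pad_part ld) (pad_sumn ld) (T lam)).
  exact: (comp_specht v (existT _ lam k0)).
move=> g.
pose y i : tabloid_rep F n (pad (tag i) n) :=
  gsum true (col_stab (pad lam n) (T lam))
    (gsum false (row_stab (pad lam n) (T lam)) (rep_act g (comp v i))).
have E : \sum_(i <- idx) phi (y i) = 0.
  transitivity (b lam (a lam (rep_act g (Phi v)))); last by rewrite v0 linear0 !gsum0.
  rewrite /Phi linear_sum !gsum_sum; apply: eq_bigr => i _.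
  by rewrite !phi_gsum phi_act.
have y_other i : tag i != lam -> y i = 0.
  move=> il; apply/eqP/negPn/negP => nz; move/eqP: il; apply.
  apply/esym/(pad_inj ld (pad_tag i)).
  apply: (shape_unique (pad_part ld) (pad_sumn ld) (pad_part (pad_tag i)) (pad_sumn (pad_tag i)) _ nz).
  exact: (submodA (@specht_submodule F n (pad (tag i) n))).
pose J k : I := existT _ lam k.
have line k : exists c, y (J k) = c *: polytabloid F (pad lam n) (T lam).
  apply: (col_gsum_line (pad_part ld) (pad_sumn ld)).
  apply: (gsum_submod _ _ (in_tabloids_submodule F n (pad lam n))).
  apply: (submodA (in_tabloids_submodule F n (pad lam n))).
  exact: specht_tabloids (comp_specht v (J k)).
pose c k := sval (cid (line k)).
have cE k : y (J k) = c k *: polytabloid F (pad lam n) (T lam) := svalP (cid (line k)).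
suff c0 : forall k, c k = 0 by rewrite -[LHS]/(y (J k0)) cE c0 scale0r.
have idxE : perm_eq [seq i <- idx | tag i == lam] [seq J k | k <- enum 'I_(mult lam)].
  apply: uniq_perm; first exact: filter_uniq.
    by rewrite map_inj_uniq ?enum_uniq // => k k' e; apply/eqP; have /eqP := e; rewrite eq_Tagged.
  move=> [l k1]; rewrite mem_filter mem_idx andbT /=; apply/eqP/mapP => [e|[k2 _ e2]];
    last exact: (congr1 tag e2).
  by subst l; exists k1; rewrite ?mem_enum.
have E2 : b lam (\sum_k c k *: mv (J k)) = 0.
  rewrite gsum_sum -[RHS]E (bigID (fun i : I => tag i == lam)) /= [X in _ + X]big1 ?addr0 => [|i il].
    rewrite -[RHS]big_filter (perm_big _ idxE) big_map big_enum; apply: eq_bigr => k _ /=.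
    rewrite cE phiZ gsumZ; congr (_ *: _); rewrite /phi /= tabloid_map_poly ?pad_sumn // => s.
    exact: mult_vector_row (mvP (J k)).
  by rewrite y_other // phi0.
have sum_mv : mult_vector lam (\sum_k c k *: mv (J k)).
  by apply/mult_spaceP; apply: memv_suml => k _; apply: memvZ; apply/mult_spaceP; exact: mvP (J k).
apply: (free_seq_eq0 (basis_free (vbasisP (mult_space lam)))); first by rewrite size_tuple multE.
exact: mult_vector_col_inj sum_mv E2.
Qed.

Let e_sub (i : I) :
  polytabloid F (pad (tag i) n) (T (tag i)) \in sub_pred (Defs.span (@is_polytabloid F n (pad (tag i) n))).
Proof.
apply/asboolP; exists 1%N, (fun=> 1), (fun=> polytabloid F (pad (tag i) n) (T (tag i))).
by split; [move=> _; eexists | rewrite big_ord1 scale1r].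
Qed.

(* The polytabloid of the chosen tableau, in the summand of index [i]. *)
Let single (i : I) : Defs.dprod (fun i : I => W i) :=
  (dfwith (fun j => 0 : W j) (exist (fun u => u \in sub_pred _) _ (e_sub i) : W i)
    : dprod_sort (fun i : I => W i)).

Let single_sub i : single i \in sub_pred (@finitely_supported F n I (fun i : I => W i)).
Proof.
apply/asboolP; exists [:: i] => j; rewrite inE => ji.
by rewrite /single dfwith_out // eq_sym.
Qed.

Let Phi_single i : exists u : D, Phi u = b (tag i) (mv i).
Proof.
exists (exist (fun u => u \in sub_pred _) _ (single_sub i) : D).
rewrite /Phi (bigD1_seq i) ?mem_idx ?idx_uniq //=.
rewrite big1 ?addr0 => [|j ji].
  rewrite -tabloid_map_poly ?pad_sumn //; last by move=> s; apply: mult_vector_row.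
  by rewrite /phi /comp /= /single /subrep_val /= dfwith_in.
have -> : comp (exist (fun u => u \in sub_pred _) _ (single_sub i) : D) j = 0.
  by rewrite /comp /subrep_val /= /single dfwith_out // eq_sym.
exact: phi0.
Qed.

Let Im v := exists u : D, Phi u = v.

Let Im_submodule : is_submodule Im.
Proof.
split.
- by exists 0; apply: linear_fun0 Phi_linear.
- by move=> c u v [u' <-] [v' <-]; exists (c *: u' + v'); rewrite Phi_linear.
- by move=> s v [v' <-]; exists (rep_act s v'); rewrite Phi_act.
Qed.

Let Im_col lam v : pad_defined lam n -> mult_vector lam v -> Im (b lam v).
Proof.
move=> ld /mult_spaceP hv; rewrite (coord_vbasis hv) gsum_sum.
apply: (submod_sum Im_submodule) => k _; rewrite gsumZ; apply: (submodZ Im_submodule).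
have [u <-] := Phi_single (existT _ lam (cast_ord (esym (multE ld)) k)).
by exists u.
Qed.

Let Phi_image v : S v <-> exists u, Phi u = v.
Proof.
split=> [Sv|[u <-]]; last exact: Phi_sub.
apply: contrapT => nI.
have Im_sub u : Im u -> S u by case=> w <-; apply: Phi_sub.
have [lam [w [ld mw wI bw]]] := mult_vector_orthogonal Im_submodule Im_sub Sv nI.
(* the column sum of w lies in Im, yet it is not orthogonal to w *)
have := @dot_gsum_neq0 _ _ _ h true (col_stab_group (pad lam n) (T lam)) w bw.
by rewrite dotC wI ?rmorph0 ?eqxx //; apply: Im_col ld mw.
Qed.

Theorem word_decomposition : rep_iso (subrep HS) D.
Proof. exact: (iso_of_image HS Phi_linear Phi_inj Phi_act Phi_image).1. Qed.

End Decomposition.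

(** * Extension by one point *)
Notation lift_last s := (lift_perm ord_max ord_max s).

Lemma lift_last_ex n (s : 'S_n.+1) : s ord_max = ord_max -> exists r : 'S_n, s = lift_last r.
Proof.
move=> sm.
have ex x : exists y, s (lift ord_max x) = lift ord_max y.
  case: (unliftP ord_max (s (lift ord_max x))) => [y ->|e]; first by exists y.
  have /perm_inj/eqP : s (lift ord_max x) = s ord_max by rewrite e sm.
  by rewrite eq_sym (negbTE (neq_lift _ _)).
have ex' x : exists y, s (lift ord_max x) == lift ord_max y.
  by have [y ->] := ex x; exists y.
pose f x := xchoose (ex' x).
have fE x : s (lift ord_max x) = lift ord_max (f x) by apply/eqP/(xchooseP (ex' x)).
have f_inj : injective f.
  by move=> x y e; apply: (@lift_inj _ ord_max); apply: (@perm_inj _ s); rewrite !fE e.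
exists (perm f_inj); apply/permP => x.
case: (unliftP ord_max x) => [y|] ->; last by rewrite lift_perm_id.
by rewrite lift_perm_lift permE fE.
Qed.

Lemma lift_last_inj n : injective (fun r : 'S_n => lift_last r).
Proof.
move=> r r' e; apply/permP => x; apply: (@lift_inj _ ord_max).
by rewrite -!(lift_perm_lift ord_max) e.
Qed.

Section Ext.
Context (F : numClosedFieldType) (A : finType) (o : A).

Definition word_restr n (w : word A n.+1) : word A n := [ffun x => w (lift ord_max x)].
Definition word_ext n (w : word A n) : word A n.+1 :=
  [ffun x => if unlift ord_max x is Some y then w y else o].
Definition fun_ext n (f : word_fun F A n) : word_fun F A n.+1 :=
  [ffun w : word A n.+1 => if w ord_max == o then f (word_restr w) else 0].

Lemma word_ext_max n (w : word A n) : word_ext w ord_max = o.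
Proof. by rewrite ffunE unlift_none. Qed.

Lemma fun_extE n (f : word_fun F A n) w :
  fun_ext f w = if w ord_max == o then f (word_restr w) else 0.
Proof. exact: ffunE. Qed.

Lemma fun_ext_linear n : linear (@fun_ext n).
Proof.
by move=> a f g; apply/ffunP => w; rewrite !ffunE; case: eqP; rewrite // scaler0 addr0.
Qed.
HB.instance Definition _ n := GRing.isLinear.Build F (word_fun F A n) (word_fun F A n.+1) _
  (@fun_ext n) (@fun_ext_linear n).

Lemma fun_ext_act n (s : 'S_n) (f : word_rep F A n) :
  fun_ext (rep_act s f) = rep_act (lift_last s) (fun_ext f : word_rep F A n.+1).
Proof.
apply/ffunP => w; rewrite /rep_act /= !ffunE lift_perm_id; case: eqP => // _.
congr (f _); apply/ffunP => x.
by rewrite !ffunE lift_perm_lift.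
Qed.

Definition weight n (w : word A n) := #|[set x | w x != o]|.

Section Tableaux.
Context (n : nat) (nu nu' : seq nat) (t : 'S_n) (t' : 'S_n.+1).
Hypothesis tt' : forall x, cell_of nu' t' (lift ord_max x) = cell_of nu t x.

Lemma lift_fiber (T : eqType) (f : nat * nat -> T) (r : 'S_n) :
  (forall x, f (cell_of nu t (r x)) = f (cell_of nu t x)) <->
  (forall x, f (cell_of nu' t' (lift_last r x)) = f (cell_of nu' t' x)).
Proof.
split=> h x; last by have := h (lift ord_max x); rewrite lift_perm_lift !tt'.
case: (unliftP ord_max x) => [y|] ->; last by rewrite lift_perm_id.
by rewrite lift_perm_lift !tt'.
Qed.

Lemma lift_row r : (lift_last r \in row_stab nu' t') = (r \in row_stab nu t).
Proof. by apply/row_stabP/row_stabP => /(lift_fiber fst). Qed.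
Lemma lift_col r : (lift_last r \in col_stab nu' t') = (r \in col_stab nu t).
Proof. by apply/col_stabP/col_stabP => /(lift_fiber snd). Qed.

(** The row permutations of the smaller tableau are row permutations of the larger one, whose sum
    absorbs them. *)
Lemma row_gsum_ext (f : word_rep F A n) :
  gsum (V := word_rep F A n.+1) false (row_stab nu' t') (fun_ext (gsum false (row_stab nu t) f)) =
  #|row_stab nu t|%:R *: gsum (V := word_rep F A n.+1) false (row_stab nu' t') (fun_ext f).
Proof.
rewrite [X in fun_ext X]gsumE.
rewrite (linear_fun_sum (@fun_ext_linear n)) gsum_sum scaler_nat -sumr_const.
apply: eq_bigr => s sR; rewrite andFb expr0 scale1r fun_ext_act.
rewrite (@gsum_act _ _ _ false (row_stab_group nu' t')) ?andFb ?expr0 ?scale1r //.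
by rewrite /= lift_row.
Qed.

(** If the new entry is alone in its column, then the column permutations are the same. *)
Lemma col_gsum_ext (f : word_rep F A n) :
  (forall x, tcol nu' t' x = tcol nu' t' ord_max -> x = ord_max) ->
  gsum (V := word_rep F A n.+1) true (col_stab nu' t') (fun_ext f) =
  fun_ext (gsum true (col_stab nu t) f).
Proof.
move=> alone; have -> : col_stab nu' t' = [set lift_last s | s in col_stab nu t].
  apply/setP => s; apply/idP/imsetP => [sC|[r rC ->]]; last by rewrite lift_col.
  have [r rE] := lift_last_ex (alone _ (elimT (col_stabP nu' t' s) sC ord_max)).
  by exists r => //; rewrite -lift_col -rE.
rewrite !gsumE (linear_fun_sum (@fun_ext_linear n)) big_imset /=; last first.
  by move=> r r' _ _; apply: lift_last_inj.
apply: eq_bigr => s _; rewrite odd_lift_perm fun_ext_act.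
by rewrite addbb.
Qed.

(** On a word ending with the base letter, a row permutation contributes only if it puts a base
    letter in the last position; it may then be corrected by a transposition of two base letters
    so as to fix the last point, and the invariance of [v] shows that it contributes the value of
    [v] on the shortened word.  The result is a positive multiple of that value. *)
Lemma row_ext_inj (v : word_rep F A n) :
  (forall s, s \in row_stab nu t -> rep_act s v = v) ->
  gsum (V := word_rep F A n.+1) false (row_stab nu' t') (fun_ext v) = 0 -> v = 0.
Proof.
move=> vinv v0; apply/ffunP => w; rewrite [RHS]ffunE.
have := congr1 (fun f : word_fun F A n.+1 => f (word_ext w)) v0.
rewrite gsumE sum_ffunE ffunE.
rewrite (bigID (fun s : 'S_n.+1 => word_ext w (s ord_max) == o)) /=.
rewrite [X in _ + X]big1 ?addr0 => [|s /andP[_ /negbTE so]]; last first.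
  by rewrite expr0 scale1r word_repE fun_extE word_permE so.
rewrite (eq_bigr (fun=> v w)) => [|s /andP[sR so]]; last first.
  rewrite expr0 scale1r word_repE fun_extE word_permE so.
  pose s' := (s * tperm (s ord_max) ord_max)%g.
  have wE : word_perm (word_ext w) s = word_perm (word_ext w) s'.
    apply/ffunP => x; rewrite !word_permE permM.
    by case: tpermP => [->|->|//]; rewrite ?word_ext_max ?(eqP so).
  have s'm : s' ord_max = ord_max by rewrite permM tpermL.
  have [r rE] := lift_last_ex s'm.
  have rR : r \in row_stab nu t.
    rewrite -lift_row -rE /s' groupM //; apply/row_stabP => x.
    have sm := elimT (row_stabP nu' t' s) sR ord_max.
    by case: tpermP => // ->.
  rewrite wE rE -{2}(vinv r rR) word_repE; congr (v _).
  by apply/ffunP => x; rewrite !ffunE lift_perm_lift liftK.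
rewrite sumr_const -mulr_natl => /eqP; rewrite mulf_eq0 pnatr_eq0 => /orP[|/eqP//].
move=> /eqP/card0_eq/(_ 1%g); rewrite -topredE /= perm1 word_ext_max eqxx andbT.
by rewrite (group1 (row_stab_group nu' t')).
Qed.

End Tableaux.

Definition word_trunc m n (u : word A m) : word A n :=
  [ffun x => if insub (val x) is Some y then u y else o].

(** As long as a word has a letter other than [o] at a position beyond [k + d], the bound on the
    weight leaves an [o] between [k] and [k + d] to exchange it with. *)
Lemma bounded_weight_det n k d (v : word_fun F A n) : (k + d <= n)%N ->
  (forall w, v w != 0 -> (weight w <= d)%N) ->
  (forall (x y : 'I_n) w, (k <= x)%N -> (k <= y)%N -> v (word_perm w (tperm x y)) = v w) ->
  (forall u : word A (k + d), v (word_trunc n u) = 0) -> v = 0.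
Proof.
move=> kdn vw vinv v0; apply/ffunP => w; rewrite ffunE.
pose far (w : word A n) := #|[set x : 'I_n | (w x != o) && (k + d <= x)%N]|.
elim: {w}(far w) {-2}w (leqnn (far w)) => [|m IH] w.
  rewrite leqn0 => /eqP/cards0_eq/setP far0.
  rewrite -(v0 [ffun y => w (widen_ord kdn y)]); congr (v _); apply/ffunP => x.
  rewrite ffunE; case: insubP => [y _ yx|]; first by rewrite ffunE; congr (w _); apply: val_inj.
  by rewrite -leqNgt => xkd; have := far0 x; rewrite !inE xkd andbT => /negbFE/eqP.
move=> far_m; have [->//|nz] := eqVneq (v w) 0.
have [/eqP far0|/set0Pn[x]] := boolP ([set x : 'I_n | (w x != o) && (k + d <= x)%N] == set0).
  by apply: IH; rewrite /far far0 cards0.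
rewrite inE => /andP[wx kx].
have lt_n (i : 'I_d) : (k + i < n)%N by apply: leq_trans kdn; rewrite ltn_add2l.
have [i wi] : exists i : 'I_d, w (Ordinal (lt_n i)) = o.
  have [i /eqP|no] := pickP (fun i : 'I_d => w (Ordinal (lt_n i)) == o); first by exists i.
  suff : ~~ (weight w <= d)%N by rewrite vw.
  rewrite -ltnNge.
  have <- : #|[set Ordinal (lt_n i) | i : 'I_d]| = d.
    by rewrite card_imset ?card_ord // => i j [] /addnI/val_inj.
  apply: (@leq_ltn_trans #|[set y | w y != o] :\ x|); last first.
    by rewrite /weight [X in (_ < X)%N](cardsD1 x) inE wx.
  apply: subset_leq_card; apply/subsetP => _ /imsetP[i _ ->]; rewrite !inE no andbT.
  by apply: contraTneq kx => <-; rewrite -ltnNge /= ltn_add2l.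
set y := Ordinal (lt_n i) in wi.
have xk : (k <= x)%N := leq_trans (leq_addr _ _) kx.
rewrite -(vinv x y) ?leq_addr //; apply: IH; rewrite -ltnS; apply: leq_trans far_m.
rewrite [X in (_ < X)%N]/far (cardsD1 x) inE wx kx ltnS; apply: subset_leq_card.
apply/subsetP => z; rewrite !inE word_permE; case: tpermP => [->|->|zx _ //].
  by rewrite wi eqxx.
  by move=> /andP[_]; rewrite leqNgt ltn_add2l ltn_ord.
by move/eqP: zx => ->.
Qed.

End Ext.

Lemma mono_bounded_const (f : nat -> nat) N0 B :
  (forall n, (N0 <= n)%N -> (f n <= f n.+1)%N) -> (forall n, (N0 <= n)%N -> (f n <= B)%N) ->
  exists N, forall n, (N <= n)%N -> (N0 <= n)%N /\ f n = f n.+1.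
Proof.
move=> mono bnd.
pose P m := `[< exists2 n, (N0 <= n)%N & f n = m >].
have Pex : exists m, P m by exists (f N0); apply/asboolP; exists N0.
have Pub m : P m -> (m <= B)%N by move=> /asboolP[n nN <-]; apply: bnd.
case: (ex_maxnP Pex Pub) => m /asboolP[N NN0 fN] max_m.
exists N => n Nn; have N0n := leq_trans NN0 Nn; split=> //.
have fm k : (N <= k)%N -> f k = m.
  move=> Nk; apply/eqP; rewrite eqn_leq max_m /=; last first.
    by apply/asboolP; exists k => //; apply: leq_trans Nk.
  rewrite -fN; elim: k Nk => [|k IH]; first by rewrite leqn0 => /eqP->.
  rewrite leq_eqVlt => /orP[/eqP->//|]; rewrite ltnS => Nk.
  by apply: leq_trans (IH Nk) (mono _ (leq_trans NN0 Nk)).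
by rewrite !fm // ltnW.
Qed.

(** * Standard tableaux of padded shapes *)

(** The entries below [sumn (parts lam)] fill the lower rows and the others fill the first row from
    left to right, so that the cell of an entry does not depend on the number of points: the
    tableaux of [pad lam n] for varying [n] extend each other. *)
Definition std_cell (lam : intpart) (x : nat) : nat * nat :=
  if (x < sumn (parts lam))%N then
    let c := nth (0, 0)%N (cells (parts lam)) x in (c.1.+1, c.2)
  else (0, x - sumn (parts lam))%N.

Definition std_tableau lam n : 'S_n :=
  odflt 1%g [pick t : 'S_n | [forall x, cell_of (pad lam n) t x == std_cell lam x]].

Lemma tableau_ex n nu (g : 'I_n -> nat * nat) : sumn nu = n -> injective g ->
  (forall x, g x \in cells nu) -> exists t : 'S_n, forall x, cell_of nu t x = g x.
Proof.
move=> nun ginj gmem.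
have lt x : (index (g x) (cells nu) < n)%N.
  by rewrite -[X in (_ < X)%N]nun -size_cells index_mem.
have inj : injective (fun x => Ordinal (lt x)).
  by move=> x y [] /(congr1 (nth (0, 0)%N (cells nu))); rewrite !nth_index // => /ginj.
by exists (perm inj) => x; rewrite /cell_of permE /= nth_index.
Qed.

Section Std.
Context (lam : intpart).
Let l := parts lam.
Let k := sumn l.

Lemma std_mem x : (x < k)%N -> exists r c,
  [/\ std_cell lam x = (r.+1, c), (r < size l)%N & (c < nth 0 l r)%N].
Proof.
move=> xk; rewrite /std_cell xk; set c := nth _ _ _.
have : c \in cells l by apply: mem_nth; rewrite size_cells.
by case: c => r c; rewrite mem_cells => /andP[h1 h2]; exists r, c.
Qed.

Lemma std_large x : (k <= x)%N -> std_cell lam x = (0, x - k)%N.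
Proof. by move=> h; rewrite /std_cell ltnNge h. Qed.

Lemma std_inj x y : std_cell lam x = std_cell lam y -> x = y.
Proof.
have [xk|kx] := ltnP x k; have [yk|ky] := ltnP y k.
- rewrite /std_cell xk yk => -[h1 h2]; apply/eqP.
  rewrite -(@nth_uniq _ (0, 0)%N (cells l)) ?size_cells ?cells_uniq //.
  by rewrite [X in X == _]surjective_pairing h1 h2 -surjective_pairing.
- by rewrite (std_large ky); have [r [c [-> _ _]]] := std_mem xk.
- by rewrite (std_large kx); have [r [c [-> _ _]]] := std_mem yk.
by rewrite !std_large // => -[] /(congr1 (addn^~ k)); rewrite !subnK.
Qed.

Lemma std_tableauP n x : pad_defined lam n ->
  cell_of (pad lam n) (std_tableau lam n) x = std_cell lam x.
Proof.
move=> ld; rewrite /std_tableau; case: pickP => [t /forallP h|no]; first exact/eqP.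
have [|y|t tP] := @tableau_ex n (pad lam n) (fun x : 'I_n => std_cell lam x) (pad_sumn ld).
- by move=> y z /std_inj/val_inj.
- rewrite pad_eq; last by apply: pad_lt => //; apply: leq_ltn_trans (ltn_ord y).
  have [yk|ky] := ltnP y k.
    by have [r [c [-> h1 h2]]] := std_mem yk; rewrite mem_cells /= ltnS h1.
  by rewrite (std_large ky) mem_cells /= ltn_sub2r // (leq_ltn_trans ky).
by have := no t; rewrite (introT forallP) // => y; rewrite tP.
Qed.

Lemma std_alone n (x : 'I_n.+1) : pad_defined lam n -> (k <= n)%N ->
  (std_cell lam x).2 = (std_cell lam n).2 -> x = ord_max.
Proof.
move=> ld kn; rewrite (std_large kn) /= => e; apply: val_inj => /=.
have [xk|kx] := ltnP x k; last first.
  by move: e; rewrite (std_large kx) /= => /(congr1 (addn^~ k)); rewrite !subnK.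
have [r [c [E h1 h2]]] := std_mem xk; move: e; rewrite E /= => e.
have : (c < n - k)%N.
  apply: leq_trans h2 _; apply: leq_trans (nth_part (valP lam) (leq0n r)) _.
  by rewrite leq_subRL // nth0.
by rewrite e ltnn.
Qed.

Lemma pad_definedS n m : (n <= m)%N -> pad_defined lam n -> pad_defined lam m.
Proof. by move=> nm h; apply: leq_trans h nm. Qed.

End Std.

(** * Stability of chains of word modules *)

Section Family.
Context (F : numClosedFieldType) (A : finType) (o : A) (d : nat).
Context (S : forall n, word_rep F A n -> Prop) (HS : forall n, is_submodule (@S n)).
Hypothesis S_ext : forall n f, @S n f -> S (fun_ext o f : word_rep F A n.+1).
Hypothesis S_weight : forall n f w, @S n f -> (f : word_fun F A n) w != 0 -> (weight o w <= d)%N.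

Notation T := (fun n lam => std_tableau lam n).
Notation mvector n lam := (mult_vector (@S n) (T n) lam).
Notation mspace n lam := (mult_space (HS n) (T n) lam).
Notation a n lam v := (gsum (V:=word_rep F A n) false (row_stab (pad lam n) (std_tableau lam n)) v).
Notation b n lam v := (gsum (V:=word_rep F A n) true (col_stab (pad lam n) (std_tableau lam n)) v).

(** The column sum of [v] vanishes on a word with two base letters in one column, since it changes
    sign under their transposition.  A word on which it does not vanish therefore has at most as
    many base letters as there are columns, namely [n - sumn (parts lam)]. *)
Lemma mult_vector_weight n lam v : pad_defined lam n -> mvector n lam v -> v != 0 ->
  (sumn (parts lam) <= d)%N.
Proof.
move=> ld hv nz.
have bv : b n lam v != 0 by apply: contraNneq nz => /(mult_vector_col_inj hv) ->.
have [w bw] : exists w, (b n lam v : word_fun F A n) w != 0.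
  apply: contrapT => no; move/eqP: bv; apply; apply/ffunP => w; rewrite ffunE.
  by apply: contrapT => /eqP h; apply: no; exists w.
have Sb : S (b n lam v) by apply: gsum_submod (HS n) (mult_vector_sub (HS n) hv).
apply: leq_trans (S_weight Sb bw).
have base_col x y : w x = o -> w y = o ->
    tcol (pad lam n) (std_tableau lam n) x = tcol (pad lam n) (std_tableau lam n) y -> x = y.
  move=> wx wy cxy; apply/eqP; apply: contraNT bw => xy.
  have tC : tperm x y \in col_stab_group (pad lam n) (std_tableau lam n).
    by apply/col_stabP => z; case: tpermP => // ->.
  have := congr1 (fun f : word_fun F A n => f w) (act_gsum true v tC).
  rewrite word_repE odd_tperm xy andbT expr1 scaleN1r [RHS]ffunE.
  have -> : word_perm w (tperm x y) = w.
    by apply/ffunP => z; rewrite word_permE; case: tpermP => [->|->|//]; rewrite wx wy.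
  move/eqP; rewrite -addr_eq0 -mulr2n -mulr_natl mulf_eq0 pnatr_eq0 /=.
  by [].
have base_le : (#|[set x | w x == o]| <= n - sumn (parts lam))%N.
  rewrite -(pad_nth0 ld) cardE -(size_map (fun x => tcol (pad lam n) (std_tableau lam n) x)).
  rewrite -[X in (_ <= X)%N](size_iota 0); apply: uniq_leq_size.
    by rewrite map_inj_in_uniq ?enum_uniq // => x y; rewrite !mem_enum !inE => /eqP + /eqP; apply: base_col.
  move=> _ /mapP[x _ ->]; rewrite mem_iota add0n /=.
  by apply: leq_trans (tcol_lt _ (pad_sumn ld) x) (nth_part (pad_part ld) (leq0n _)).
have base_card : (#|[set x | w x == o]| + weight o w)%N = n.
  rewrite /weight -[X in (_ + X)%N](_ : #|~: [set x | w x == o]| = _) ?cardsC ?card_ord //.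
  by apply: eq_card => x; rewrite !inE.
rewrite -(leq_add2l (n - sumn (parts lam))) subnK ?(pad_le ld) // -[X in (X <= _)%N]base_card.
by rewrite leq_add2r.
Qed.

Lemma mult_weight lam n : mult (HS n) (T n) lam != 0%N -> (sumn (parts lam) <= d)%N.
Proof.
rewrite /mult; case: ifP => // ld; rewrite dimv_eq0 -vpick0 => nz.
by apply: (mult_vector_weight ld _ nz); apply/(mult_spaceP (HS n)); apply: memv_pick.
Qed.

Section Tau.
Context (lam : intpart).
Let k := sumn (parts lam).

(* Symmetrizing the extension by [o] over the enlarged first row; the lower rows only contribute
   a factor. *)
Definition tau n (v : word_fun F A n) : word_fun F A n.+1 := a n.+1 lam (fun_ext o v).

Lemma tau_linear n : linear (@tau n).
Proof. by move=> c u v; rewrite /tau !linearP. Qed.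

Context (n : nat) (ld : pad_defined lam n).
Let ld' : pad_defined lam n.+1 := pad_definedS (leqnSn n) ld.

Let std_lift x : cell_of (pad lam n.+1) (std_tableau lam n.+1) (lift ord_max x) =
                 cell_of (pad lam n) (std_tableau lam n) x.
Proof. by rewrite !std_tableauP // lift_max. Qed.

Lemma tau_mult_vector v : mvector n lam v -> mvector n.+1 lam (tau v).
Proof.
move=> [z Sz ->]; rewrite /tau (row_gsum_ext o std_lift).
exists (#|row_stab (pad lam n) (std_tableau lam n)|%:R *: (fun_ext o z : word_rep F A n.+1)).
  by apply: (submodZ (HS n.+1)); apply: S_ext.
rewrite !gsumZ; congr (_ *: gsum _ _ _); rewrite (col_gsum_ext o std_lift) // => x.
by rewrite !std_tableauP //=; apply: std_alone => //; apply: pad_le.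
Qed.

Lemma tau_inj v : mvector n lam v -> tau v = 0 -> v = 0.
Proof.
by move=> hv; apply: (row_ext_inj std_lift) => s; apply: mult_vector_row hv.
Qed.

Let Tau : 'Hom(word_fun F A n, word_fun F A n.+1) :=
  linfun (HB.pack_for {linear word_fun F A n -> word_fun F A n.+1} (@tau n)
    (GRing.isLinear.Build F (word_fun F A n) (word_fun F A n.+1) _ (@tau n) (@tau_linear n))).

Let TauE v : Tau v = tau v. Proof. by rewrite lfunE. Qed.

Let Tau_sub : (Tau @: mspace n lam <= mspace n.+1 lam)%VS.
Proof.
apply/subvP => _ /memv_imgP[v /(mult_spaceP (HS n)) hv ->].
by rewrite TauE; apply/mult_spaceP; apply: tau_mult_vector.
Qed.

Let Tau_dim : \dim (Tau @: mspace n lam) = \dim (mspace n lam).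
Proof.
apply: limg_dim_eq; apply/eqP; rewrite -subv0; apply/subvP => v.
rewrite memv_cap memv_ker TauE => /andP[/(mult_spaceP (HS n)) hv /eqP /(tau_inj hv) ->].
exact: mem0v.
Qed.

Lemma mult_space_mono : (\dim (mspace n lam) <= \dim (mspace n.+1 lam))%N.
Proof. by rewrite -Tau_dim; apply: dimvS. Qed.

Lemma tau_onto v : \dim (mspace n lam) = \dim (mspace n.+1 lam) -> mvector n.+1 lam v ->
  exists2 u, mvector n lam u & v = tau u.
Proof.
move=> e /(mult_spaceP (HS n.+1)).
have -> : mspace n.+1 lam = (Tau @: mspace n lam)%VS.
  by apply/esym/eqP; rewrite eqEdim Tau_sub Tau_dim e leqnn.
by move=> /memv_imgP[u /(mult_spaceP (HS n)) hu ->]; exists u; rewrite ?TauE.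
Qed.

Lemma mult_space_bound : (k + d <= n)%N ->
  (\dim (mspace n lam) <= \dim {: {ffun word A (k + d) -> F^o}})%N.
Proof.
move=> kdn.
pose E (v : word_fun F A n) : {ffun word A (k + d) -> F^o} := [ffun u => v (word_trunc o n u)].
have E_lin : linear E by move=> c u v; apply/ffunP => w; rewrite !ffunE.
pose EE := linfun (HB.pack_for {linear word_fun F A n -> {ffun word A (k + d) -> F^o}} E
  (GRing.isLinear.Build F (word_fun F A n) {ffun word A (k + d) -> F^o} _ E E_lin)).
have EEE v : EE v = E v by rewrite lfunE.
have <- : \dim (EE @: mspace n lam) = \dim (mspace n lam).
  apply: limg_dim_eq; apply/eqP; rewrite -subv0; apply/subvP => v.
  rewrite memv_cap memv_ker EEE memv0 => /andP[/(mult_spaceP (HS n)) hv /eqP Ev].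
  apply/eqP; apply: (bounded_weight_det kdn) => [w|x y w kx ky|u].
  - exact: S_weight (mult_vector_sub (HS n) hv).
  - rewrite -word_repE (mult_vector_row hv) //; apply/row_stabP => z.
    by case: tpermP => // ->; rewrite !std_tableauP // !std_large.
  by have := congr1 (fun f : {ffun word A (k + d) -> F^o} => f u) Ev; rewrite !ffunE.
exact: dimvS (subvf _).
Qed.

End Tau.

(** The dimension is increasing and bounded; once it is constant, [tau] is onto. *)
Lemma mult_eventually_const lam : exists N, forall n, (N <= n)%N ->
  [/\ pad_defined lam n, \dim (mspace n lam) = \dim (mspace n.+1 lam) &
      mult (HS n) (T n) lam = mult (HS n.+1) (T n.+1) lam].
Proof.
pose N0 := maxn (sumn (parts lam) + head 0%N (parts lam)) (sumn (parts lam) + d).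
have ld n : (N0 <= n)%N -> pad_defined lam n by rewrite geq_max => /andP[].
have [||N NP] := @mono_bounded_const (fun n => \dim (mspace n lam)) N0
   (\dim {: {ffun word A (sumn (parts lam) + d) -> F^o}}).
- by move=> n /ld; apply: mult_space_mono.
- move=> n Nn; apply: mult_space_bound; first exact: ld.
  by move: Nn; rewrite geq_max => /andP[].
exists N => n /NP[N0n e]; have l := ld n N0n; split=> //.
by rewrite /mult l (pad_definedS (leqnSn n) l).
Qed.

(** A vector of the multiplicity space of [lam] orthogonal to the submodule generated by the
    previous term is in the image of [tau], hence in that submodule, hence zero. *)
Theorem word_family_stable : exists N, forall n, (N <= n)%N ->
  (forall lam, mult (HS n) (T n) lam = mult (HS n.+1) (T n.+1) lam) /\
  forall Z : word_rep F A n.+1 -> Prop, is_submodule Z ->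
    (forall f, S f -> Z (fun_ext o f)) -> forall v, @S n.+1 v -> Z v.
Proof.
have [s [_ sP]] := intpart_finite d.
pose Nl lam := sval (cid (mult_eventually_const lam)).
have NlP lam := svalP (cid (mult_eventually_const lam)).
exists (\max_(lam <- s) Nl lam)%N => n Nn.
have NlE lam : (sumn (parts lam) <= d)%N -> (Nl lam <= n)%N.
  by move=> /sP ls; apply: leq_trans Nn; apply: leq_bigmax_seq.
split=> [lam|Z HZ SZ v Sv].
  have [le|gt] := leqP (sumn (parts lam)) d; first by have [] := NlP lam n (NlE lam le).
  have m0 m : mult (HS m) (T m) lam = 0%N.
    by apply/eqP; apply: contraTT gt => /mult_weight; rewrite -leqNgt.
  by rewrite !m0.
apply: contrapT => nZv.
pose Im u := @S n.+1 u /\ Z u.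
have HI : is_submodule Im.
  split=> [|c u w [Su Zu] [Sw Zw]|g w [Sw Zw]]; split.
  - exact: submod0 (HS _).
  - exact: submod0 HZ.
  - by apply: (submodD (HS _)) => //; apply: (submodZ (HS _)).
  - by apply: (submodD HZ) => //; apply: (submodZ HZ).
  - exact: (submodA (HS _)).
  - exact: (submodA HZ).
have [lam [w [ld mv wI bw]]] := mult_vector_orthogonal (HS n.+1) (T n.+1) HI (fun u (Iu : Im u) => Iu.1)
  Sv (fun Iv => nZv Iv.2).
have wn : w != 0 by apply: contraNneq bw => ->; rewrite gsum0.
have [ldn dimE _] := NlP lam n (NlE lam (mult_vector_weight ld mv wn)).
have [u hu wE] := tau_onto ldn dimE mv.
have Iw : Im w.
  split; first exact: (mult_vector_sub (HS n.+1) mv).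
  by rewrite wE; apply: (gsum_submod _ _ HZ); apply: SZ; apply: mult_vector_sub hu.
by move/eqP: wn; apply; apply: (dot_eq0 (wI w Iw)).
Qed.

End Family.

(** * Polynomials in one more pair of variables *)

Lemma mpoly_linear_eq (F : fieldType) n (V : lmodType F) (f g : {mpoly F[n]} -> V) :
  linear f -> linear g -> (forall m, f 'X_[m] = g 'X_[m]) -> f =1 g.
Proof.
move=> fl gl e p; rewrite (mpolyE p) (linear_fun_sum fl) (linear_fun_sum gl).
by apply: eq_bigr => m _; rewrite e.
Qed.

Section VarCases.
Context (n : nat).

Lemma xymap_xvar m (f : 'I_n -> 'I_m) k : xymap f (xvar k) = xvar (f k).
Proof. by rewrite /xymap (unsplitK (inl k)). Qed.
Lemma xymap_yvar m (f : 'I_n -> 'I_m) k : xymap f (yvar k) = yvar (f k).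
Proof. by rewrite /xymap (unsplitK (inr k)). Qed.

Lemma var_ind (P : 'I_(n + n) -> Prop) :
  (forall k, P (xvar k)) -> (forall k, P (yvar k)) -> forall k, P k.
Proof. by move=> hx hy k; rewrite -(splitK k); case: (split k). Qed.

Lemma xvar_inj : injective (@xvar n). Proof. exact: lshift_inj. Qed.
Lemma yvar_inj : injective (@yvar n). Proof. exact: rshift_inj. Qed.
Lemma xvar_yvar k l : (@xvar n k == yvar l) = false. Proof. exact: eq_lrshift. Qed.
Lemma yvar_xvar k l : (@yvar n k == xvar l) = false. Proof. exact: eq_rlshift. Qed.

End VarCases.

Lemma xymap_comp n m l (f : 'I_n -> 'I_m) (g : 'I_m -> 'I_l) k :
  xymap g (xymap f k) = xymap (g \o f) k.
Proof.
by elim/var_ind: k => k; rewrite ?xymap_xvar ?xymap_yvar // !(xymap_xvar, xymap_yvar).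
Qed.

Lemma eq_xymap n m (f g : 'I_n -> 'I_m) : f =1 g -> xymap f =1 xymap g.
Proof. by move=> e; elim/var_ind => k; rewrite ?xymap_xvar ?xymap_yvar e. Qed.

Section Subst.
Context (F : fieldType).

Lemma xysubstXm n m (f : 'I_n -> 'I_m) (mm : 'X_{1..n + n}) :
  xysubst f 'X_[mm] = \prod_k 'X_(xymap f k) ^+ mm k :> {mpoly F[m + m]}.
Proof. by rewrite /xysubst comp_mpolyX; apply: eq_bigr => k _; rewrite tnth_mktuple. Qed.

Lemma xysubst_comp n m l (f : 'I_n -> 'I_m) (g : 'I_m -> 'I_l) (p : {mpoly F[n + n]}) :
  xysubst g (xysubst f p) = xysubst (g \o f) p.
Proof.
apply: (@mpoly_linear_eq F _ {mpoly F[l + l]} (fun p => xysubst g (xysubst f p)) (xysubst (g \o f))).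
- by move=> a q r; rewrite !xysubst_linear.
- exact: xysubst_linear.
move=> mm; rewrite !xysubstXm /xysubst rmorph_prod; apply: eq_bigr => k _.
by rewrite rmorphXn /= -/(xysubst g _) xysubstX xymap_comp.
Qed.

Lemma eq_xysubst n m (f g : 'I_n -> 'I_m) (p : {mpoly F[n + n]}) : f =1 g ->
  xysubst f p = xysubst g p.
Proof.
move=> e; apply: (@mpoly_linear_eq F _ {mpoly F[m + m]} (xysubst f) (xysubst g)).
- exact: xysubst_linear.
- exact: xysubst_linear.
by move=> mm; rewrite !xysubstXm; apply: eq_bigr => k _; rewrite (eq_xymap e).
Qed.

End Subst.

Section Incl.
Context (F : fieldType) (n : nat).
Let e : 'I_(n + n) -> 'I_(n.+1 + n.+1) := xymap (widen_ord (leqnSn n)).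

Lemma widen_lift (k : 'I_n) : widen_ord (leqnSn n) k = lift ord_max k.
Proof. by apply: val_inj; rewrite [RHS]lift_max. Qed.

Lemma incl_x k : e (xvar k) = xvar (lift ord_max k).
Proof. by rewrite /e xymap_xvar widen_lift. Qed.
Lemma incl_y k : e (yvar k) = yvar (lift ord_max k).
Proof. by rewrite /e xymap_yvar widen_lift. Qed.

Lemma incl_inj : injective e.
Proof.
elim/var_ind => k; elim/var_ind => l; rewrite ?incl_x ?incl_y.
- by move=> /xvar_inj/lift_inj->.
- by move/eqP; rewrite xvar_yvar.
- by move/eqP; rewrite yvar_xvar.
- by move=> /yvar_inj/lift_inj->.
Qed.

(* [mnm_ext] is the effect of the inclusion on exponents and [mnm_res] its left inverse; the
   monomials in the image are those satisfying [no_last]. *)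
Definition mnm_ext (m : 'X_{1..n + n}) : 'X_{1..n.+1 + n.+1} := (\sum_k U_(e k) *+ m k)%MM.
Definition mnm_res (m : 'X_{1..n.+1 + n.+1}) : 'X_{1..n + n} := [multinom m (e k) | k < n + n].

Lemma mnm_extE m k : mnm_ext m (e k) = m k.
Proof.
rewrite mnm_sumE (bigD1 k) //= mulmnE mnm1E eqxx mul1n big1 ?addn0 // => l lk.
by rewrite mulmnE mnm1E (inj_eq incl_inj) (negbTE lk).
Qed.

Lemma mnm_ext_out m j : (forall k, e k != j) -> mnm_ext m j = 0%N.
Proof. by move=> h; rewrite mnm_sumE big1 // => k _; rewrite mulmnE mnm1E (negbTE (h k)). Qed.

Lemma incl_neq_x k : e k != xvar ord_max.
Proof.
elim/var_ind: k => k; rewrite ?incl_x ?incl_y ?yvar_xvar //.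
by rewrite (inj_eq (@xvar_inj _)) eq_sym neq_lift.
Qed.
Lemma incl_neq_y k : e k != yvar ord_max.
Proof.
elim/var_ind: k => k; rewrite ?incl_x ?incl_y ?xvar_yvar //.
by rewrite (inj_eq (@yvar_inj _)) eq_sym neq_lift.
Qed.

Definition no_last (m : 'X_{1..n.+1 + n.+1}) := (m (xvar ord_max) == 0%N) && (m (yvar ord_max) == 0%N).

Lemma mnm_ext_eq m m' : (mnm_ext m == m') = no_last m' && (m == mnm_res m').
Proof.
apply/eqP/andP => [<-|[/andP[/eqP hx /eqP hy] /eqP->]].
  rewrite /no_last !mnm_ext_out //; [|exact: incl_neq_y|exact: incl_neq_x].
  by split=> //; apply/eqP/mnmP => k; rewrite mnmE mnm_extE.
apply/mnmP; elim/var_ind => k; case: (unliftP ord_max k) => [l|] ->.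
- by rewrite -incl_x mnm_extE mnmE.
- by rewrite hx mnm_ext_out //; exact: incl_neq_x.
- by rewrite -incl_y mnm_extE mnmE.
- by rewrite hy mnm_ext_out //; exact: incl_neq_y.
Qed.

Lemma poly_incl_linear : linear (@poly_incl F n).
Proof. exact: xysubst_linear. Qed.

Lemma poly_inclX m : poly_incl 'X_[m] = 'X_[mnm_ext m] :> {mpoly F[n.+1 + n.+1]}.
Proof.
rewrite /poly_incl xysubstXm /mnm_ext -mprodXE.
by apply: eq_bigr => k _; rewrite mpolyXn.
Qed.

Lemma mcoeff_incl (p : {mpoly F[n + n]}) m :
  (poly_incl p)@_m = if no_last m then p@_(mnm_res m) else 0.
Proof.
apply: (@mpoly_linear_eq F _ F^o (fun p => (poly_incl p)@_m)
  (fun p => if no_last m then p@_(mnm_res m) else 0)).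
- by move=> a q r; rewrite poly_incl_linear mcoeffD mcoeffZ.
- by move=> a q r; case: ifP => _; rewrite ?mcoeffD ?mcoeffZ // scaler0 addr0.
move=> m'; rewrite poly_inclX !mcoeffX mnm_ext_eq.
by case: no_last.
Qed.

Lemma poly_incl_inj : injective (@poly_incl F n).
Proof.
move=> p q E; apply/mpolyP => m; have := congr1 (mcoeff (mnm_ext m)) E.
rewrite !mcoeff_incl; have := mnm_ext_eq m (mnm_ext m); rewrite eqxx.
by move=> /esym/andP[-> /eqP <-].
Qed.

Lemma poly_incl_deriv k (p : {mpoly F[n + n]}) :
  poly_incl p^`M(k) = (poly_incl p)^`M(e k).
Proof.
apply: (@mpoly_linear_eq F _ _ (fun p => poly_incl p^`M(k)) (fun p => (poly_incl p)^`M(e k))).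
- by move=> a q r; rewrite mderivD mderivZ poly_incl_linear.
- by move=> a q r; rewrite poly_incl_linear mderivD mderivZ.
move=> m; rewrite poly_inclX !mderivX mnm_extE (linear_funZ poly_incl_linear) poly_inclX.
case E: (m k) => [|j]; first by rewrite !scale0r.
congr (_ *: 'X_[_]); apply/mnmP => l; rewrite mnmBE.
have [[l' ->]|no] := pselect (exists l', l = e l').
  by rewrite !mnm_extE mnmBE !mnm1E (inj_eq incl_inj).
by rewrite !mnm_ext_out // => l'; apply/eqP => h; apply: no; exists l'.
Qed.

Lemma poly_incl_derivm m : exists m', forall p : {mpoly F[n + n]},
  poly_incl p^`M[m] = (poly_incl p)^`M[m'].
Proof.
rewrite (multinomUE_id m); elim/big_ind: _ => [|a b [a' ha] [b' hb]|k _].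
- by exists 0%MM => p; rewrite !mderivm0m.
- by exists (a' + b')%MM => p; rewrite !mderivmDm hb ha.
elim: (m k) => [|j [m' hm]]; first by exists 0%MM => p; rewrite mulm0n !mderivm0m.
by exists (U_(e k) + m')%MM => p; rewrite mulmS !mderivmDm hm !mderivmU1m poly_incl_deriv.
Qed.

Lemma poly_incl_nox (p : {mpoly F[n + n]}) : (poly_incl p)^`M(xvar ord_max) = 0.
Proof.
apply: (@mpoly_linear_eq F _ _ (fun p => (poly_incl p)^`M(xvar ord_max)) (fun=> 0)).
- by move=> a q r; rewrite poly_incl_linear mderivD mderivZ.
- by move=> a q r; rewrite scaler0 addr0.
by move=> m; rewrite poly_inclX mderivX mnm_ext_out ?scale0r //; exact: incl_neq_x.
Qed.
Lemma poly_incl_noy (p : {mpoly F[n + n]}) : (poly_incl p)^`M(yvar ord_max) = 0.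
Proof.
apply: (@mpoly_linear_eq F _ _ (fun p => (poly_incl p)^`M(yvar ord_max)) (fun=> 0)).
- by move=> a q r; rewrite poly_incl_linear mderivD mderivZ.
- by move=> a q r; rewrite scaler0 addr0.
by move=> m; rewrite poly_inclX mderivX mnm_ext_out ?scale0r //; exact: incl_neq_y.
Qed.

End Incl.

Lemma mderivn_mul_const (F : fieldType) n (i : 'I_n) k (p q : {mpoly F[n]}) :
  q^`M(i) = 0 -> (p * q)^`M(i, k) = p^`M(i, k) * q.
Proof.
move=> q0; elim: k p => [|k IH] p; first by rewrite !mderivn0.
by rewrite !mderivSn mderivM q0 mulr0 addr0 IH.
Qed.

(** * The determinants *)

Section Diagram.
Context (nu : seq nat) (nuP : is_part nu).

Lemma cells_down r c r' c' : (r, c) \in cells nu -> (r' <= r)%N -> (c' <= c)%N ->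
  (r', c') \in cells nu.
Proof.
rewrite !mem_cells => /andP[h1 h2] hr hc; rewrite (leq_ltn_trans hr h1) /=.
exact: leq_trans (leq_ltn_trans hc h2) (nth_part nuP hr).
Qed.

Lemma belowE c : c \in cells nu -> below nu c = c.1.
Proof.
case: c => r c hc; rewrite /below -size_filter /= -[RHS](size_iota 0).
rewrite -(size_map (fun k => (k, c)) (iota 0 r)).
apply/perm_size/uniq_perm; first by rewrite filter_uniq ?cells_uniq.
  by rewrite map_inj_uniq ?iota_uniq // => x y [].
move=> [x y]; rewrite mem_filter /=; apply/andP/mapP => [[/andP[/eqP-> xr] _]|[k + [-> ->]]].
  by exists x; rewrite ?mem_iota.
by rewrite mem_iota add0n eqxx /= => kr; split=> //; apply: (cells_down hc) => //; apply: ltnW.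
Qed.

Lemma on_leftE c : c \in cells nu -> on_left nu c = c.2.
Proof.
case: c => r c hc; rewrite /on_left -size_filter /= -[RHS](size_iota 0).
rewrite -(size_map (fun k => (r, k)) (iota 0 c)).
apply/perm_size/uniq_perm; first by rewrite filter_uniq ?cells_uniq.
  by rewrite map_inj_uniq ?iota_uniq // => x y [].
move=> [x y]; rewrite mem_filter /=; apply/andP/mapP => [[/andP[/eqP-> xr] _]|[k + [-> ->]]].
  by exists y; rewrite ?mem_iota.
by rewrite mem_iota add0n eqxx /= => kr; split=> //; apply: (cells_down hc) => //; apply: ltnW.
Qed.
End Diagram.

Section CellDet.
Context (F : fieldType).

Definition cell_mon n (k : 'I_n) (c : nat * nat) : {mpoly F[n + n]} :=
  'X_(xvar k) ^+ c.1 * 'X_(yvar k) ^+ c.2.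

Definition cell_det n (s : seq (nat * nat)) : {mpoly F[n + n]} :=
  \det (\matrix_(k < n, l < n) cell_mon k (nth (0, 0)%N s l)).

Lemma DeltaE n nu : is_part nu -> sumn nu = n -> Delta F n nu = cell_det n (cells nu).
Proof.
move=> nuP nun; congr (\det _); apply/matrixP => k l; rewrite !mxE /=.
have lc : nth (0, 0)%N (cells nu) l \in cells nu by rewrite mem_nth // size_cells nun.
by rewrite belowE // on_leftE.
Qed.

Lemma cell_det_perm n s s' : perm_eq s s' -> size s = n ->
  exists b : bool, cell_det n s = (-1) ^+ b *: cell_det n s'.
Proof.
move=> ss' sn; have s'n : size s' == n by rewrite -sn (perm_size ss').
have sn' : size s == n by rewrite sn.
have /tuple_permP[p pE] : perm_eq (Tuple sn') (Tuple s'n) by [].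
exists (odd_perm p); rewrite /cell_det.
rewrite (_ : \matrix_(k, l) cell_mon k (nth (0, 0)%N s l) =
   col_perm p (\matrix_(k, l) cell_mon k (nth (0, 0)%N s' l))); last first.
  apply/matrixP => k l; rewrite !mxE; congr cell_mon.
  by rewrite [X in nth _ X _]pE nth_mktuple (tnth_nth (0, 0)%N).
by rewrite col_permE det_mulmx det_perm odd_permV mulrC -mul_mpolyC rmorphXn /= rmorphN1.
Qed.

Lemma cell_mon_incl n (k : 'I_n) c :
  poly_incl (cell_mon k c) = cell_mon (lift ord_max k) c.
Proof.
rewrite /cell_mon /poly_incl /xysubst rmorphM !rmorphXn /=.
by rewrite -!/(xysubst _ _) !xysubstX incl_x incl_y.
Qed.

Lemma poly_incl_det n m (M : 'M[{mpoly F[n + n]}]_m) :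
  poly_incl (\det M) = \det (map_mx (@poly_incl F n) M).
Proof.
exact: esym (det_map_mx (comp_mpoly [tuple 'X_(xymap (widen_ord (leqnSn n)) k) | k < n + n]) M).
Qed.

Lemma cell_mon_deriv n (k : 'I_n) c c0 :
  (cell_mon k c)^`M(xvar k, c0.1)^`M(yvar k, c0.2) =
  if (c0.1 <= c.1)%N && (c0.2 <= c.2)%N then
    ((c.1 ^_ c0.1 * c.2 ^_ c0.2)%:R : F) *: cell_mon k (c.1 - c0.1, c.2 - c0.2)%N
  else 0.
Proof.
have monE a : cell_mon k a = 'X_[U_(xvar k) *+ a.1 + U_(yvar k) *+ a.2].
  by rewrite mpolyXD -!mpolyXn.
rewrite !monE mderivnX mderivmZ mderivnX scalerA.
rewrite !(mnmDE, mnmBE, mulmnE, mnm1E) !eqxx xvar_yvar yvar_xvar !mul0n !mul1n addn0 add0n subn0 -natrM.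
case: ifP => [/andP[h1 h2]|]; last first.
  by move/negbT; rewrite negb_and -!ltnNge => /orP[] h; rewrite (ffact_small h) ?mul0n ?muln0 scale0r.
congr (_ *: 'X_[_]); apply/mnmP => l.
rewrite !(mnmDE, mnmBE, mulmnE, mnm1E) /=.
case: eqVneq => [<-|_]; rewrite ?yvar_xvar ?mul0n ?mul1n ?subn0 ?addn0 //.
by rewrite !mulnBr !add0n.
Qed.

(** In the expansion along the last row, the cofactors do not involve the last pair of variables,
    and the derivative of the monomial of a cell vanishes unless the cell lies weakly above and
    to the right of [c0]. *)
Lemma cell_det_corner n s c0 : size s = n ->
  (forall c, c \in s -> ~~ ((c0.1 <= c.1)%N && (c0.2 <= c.2)%N)) ->
  (cell_det n.+1 (rcons s c0))^`M(xvar ord_max, c0.1)^`M(yvar ord_max, c0.2) =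
  ((c0.1`! * c0.2`!)%:R : F) *: poly_incl (cell_det n s).
Proof.
move=> sn corner; rewrite /cell_det (expand_det_row _ ord_max).
set M := \matrix_(k, l) _.
have MM : forall j, exists q, cofactor M ord_max j = poly_incl q.
  move=> j; exists ((-1) ^+ ((ord_max : 'I_n.+1) + j)%N *:
    \det (\matrix_(k < n, l < n) cell_mon k (nth (0, 0)%N (rcons s c0) (lift j l)))).
  rewrite (linear_funZ (@poly_incl_linear F n)) -mul_mpolyC rmorphXn /= rmorphN1 /cofactor; congr (_ * _).
  rewrite poly_incl_det; congr (\det _); apply/matrixP => k l; rewrite !mxE.
  by rewrite cell_mon_incl.
have term j : (M ord_max j * cofactor M ord_max j)^`M(xvar ord_max, c0.1)^`M(yvar ord_max, c0.2) =
    (M ord_max j)^`M(xvar ord_max, c0.1)^`M(yvar ord_max, c0.2) * cofactor M ord_max j.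
  have [q ->] := MM j.
  by rewrite mderivn_mul_const ?poly_incl_nox // mderivn_mul_const ?poly_incl_noy.
set rhs := RHS; rewrite !linear_sum /= (bigD1 ord_max) //= big1 ?addr0 => [|j jm]; last first.
  rewrite term mxE cell_mon_deriv nth_rcons sn.
  have jn : (j < n)%N.
    by rewrite ltn_neqAle -ltnS ltn_ord andbT; apply: contra jm => /eqP e; apply/eqP/val_inj.
  by rewrite jn (negbTE (corner _ _)) ?mul0r // mem_nth // sn.
rewrite term mxE cell_mon_deriv nth_rcons sn ltnn eqxx !leqnn /= !ffactnn !subnn.
have -> : cell_mon (ord_max : 'I_n.+1) (0, 0)%N = 1 by rewrite /cell_mon !expr0 mulr1.
rewrite /rhs -[LHS]scalerAl mul1r; congr (_ *: _).
rewrite /cofactor -signr_odd oddD addbb expr0 mul1r.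
rewrite poly_incl_det; congr (\det _); apply/matrixP => k l; rewrite !mxE.
by rewrite cell_mon_incl nth_rcons lift_max sn ltn_ord.
Qed.

End CellDet.

(** A cell of mu weakly above and to the right of the new cell would force the new cell to lie
    in mu. *)
Lemma new_corner (mu nu : intpart) n : sumn (parts mu) = n -> sumn (parts nu) = n.+1 ->
  diagram_sub mu nu -> exists2 c0, perm_eq (cells (parts nu)) (rcons (cells (parts mu)) c0) &
    forall c, c \in cells (parts mu) -> ~~ ((c0.1 <= c.1)%N && (c0.2 <= c.2)%N).
Proof.
move=> mun nun /allP sub.
set s := cells (parts mu) in sub *; set s' := cells (parts nu) in sub *.
have ss' : perm_eq [seq c <- s' | c \in s] s.
  apply: uniq_perm; rewrite ?filter_uniq ?cells_uniq // => c.
  by rewrite mem_filter; apply: andb_idr; apply: sub.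
have pr : perm_eq s' (s ++ [seq c <- s' | c \notin s]).
  have h : perm_eq ([seq c <- s' | c \in s] ++ [seq c <- s' | c \notin s]) s'.
    by apply/permPl; apply: perm_filterC.
  by rewrite perm_sym; apply: perm_trans h; rewrite perm_cat2r perm_sym.
have : size [seq c <- s' | c \notin s] = 1%N.
  by have := perm_size pr; rewrite size_cat !size_cells mun nun -addn1 => /addnI.
case E: [seq c <- s' | c \notin s] => [//|c0 [|//]] _.
have c0s : c0 \notin s.
  have : c0 \in [seq c <- s' | c \notin s] by rewrite E inE.
  by rewrite mem_filter => /andP[].
exists c0; first by rewrite -cats1 -E.
move=> [r c] cs; apply: contra c0s => /andP[/= h1 h2]; rewrite (surjective_pairing c0).
exact: (cells_down (valP mu) cs).
Qed.

(** * Garsia-Haiman modules *)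

Section GHincl.
Context (F : numFieldType) (n : nat) (mu nu : intpart).
Hypotheses (mun : sumn (parts mu) = n) (nun : sumn (parts nu) = n.+1) (sub : diagram_sub mu nu).

Lemma Delta_incl : exists a m, poly_incl (Delta F n (parts mu)) = a *: (Delta F n.+1 (parts nu))^`M[m].
Proof.
have [c0 pr corner] := new_corner mun nun sub.
rewrite !DeltaE ?(valP mu) ?(valP nu) //.
have [|b ->] := cell_det_perm F pr (n := n.+1); first by rewrite size_cells nun.
have sz : size (cells (parts mu)) = n by rewrite size_cells.
exists (((c0.1`! * c0.2`!)%:R)^-1 * (-1) ^+ b), (U_(xvar ord_max) *+ c0.1 + U_(yvar ord_max) *+ c0.2)%MM.
rewrite mderivmZ mderivmDm cell_det_corner // !scalerA.
rewrite -[X in X * _]mulrA sign_sq mulr1 mulVf ?scale1r //.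
by rewrite pnatr_eq0 -lt0n muln_gt0 !fact_gt0.
Qed.

Lemma GH_incl p : GH (n := n) (parts mu) p -> GH (n := n.+1) (parts nu) (poly_incl (F := F) p).
Proof.
have [a [m0 D0]] := Delta_incl.
move=> [k [c [u [hu ->]]]]; have ex l : exists m, poly_incl (u l) = a *: (Delta F n.+1 (parts nu))^`M[m].
  have [m ->] := hu l; have [m' hm] := poly_incl_derivm F m.
  by exists (m0 + m')%MM; rewrite hm D0 mderivmZ mderivmDm.
exists k, (fun l => c l * a), (fun l => (Delta F n.+1 (parts nu))^`M[sval (cid (ex l))]).
split=> [l|]; first by eexists.
rewrite (linear_fun_sum (@poly_incl_linear F n)); apply: eq_bigr => l _.
by rewrite -scalerA; congr (_ *: _); exact: (svalP (cid (ex l))).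
Qed.

Lemma bihomog_incl i j (p : {mpoly F[n + n]}) : bihomog i j p -> bihomog i j (poly_incl p).
Proof.
move=> hp m; rewrite mcoeff_msupp mcoeff_incl; case: ifP => [/andP[/eqP mx /eqP my]|]; last by rewrite eqxx.
rewrite -mcoeff_msupp => /hp [<- <-]; rewrite /ydeg /xdeg.
split; rewrite (bigD1_ord ord_max) //= ?mx ?my add0n; apply: eq_bigr => k _.
  by rewrite mnmE incl_y.
by rewrite mnmE incl_x.
Qed.

End GHincl.

Lemma poly_incl_act (F : fieldType) n (s : 'S_n) (p : {mpoly F[n + n]}) :
  poly_incl (poly_act s p) = poly_act (lift_last s) (poly_incl p).
Proof.
rewrite /poly_incl /poly_act !xysubst_comp; apply: eq_xysubst => k /=.
by rewrite !widen_lift lift_perm_lift.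
Qed.

Lemma poly_incl_last_swap (F : fieldType) n (p : {mpoly F[n + n]}) :
  poly_act (last_swap n) (poly_incl (poly_incl p)) = poly_incl (poly_incl p).
Proof.
rewrite /poly_incl /poly_act !xysubst_comp; apply: eq_xysubst => k /=.
by rewrite tpermD // -val_eqE /= inordK // gtn_eqF //; apply: ltnW; rewrite ltnS.
Qed.

(** * Garsia-Haiman modules as word modules *)

Section Coefficients.
Context (F : numClosedFieldType) (i j : nat).

(** In bidegree [(i, j)] the exponents of the x's are at most [j] and those of the y's at most
    [i]. *)
Definition letter : finType := ('I_j.+1 * 'I_i.+1)%type.
Definition base_letter : letter := (ord0, ord0).

Definition word_mnm n (w : word letter n) : 'X_{1..n + n} :=
  [multinom match split k with inl l => val (w l).1 | inr l => val (w l).2 end | k < n + n].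

Lemma word_mnm_x n (w : word letter n) k : word_mnm w (xvar k) = (w k).1.
Proof. by rewrite mnmE (unsplitK (inl k)). Qed.
Lemma word_mnm_y n (w : word letter n) k : word_mnm w (yvar k) = (w k).2.
Proof. by rewrite mnmE (unsplitK (inr k)). Qed.

Definition coef_fun n (p : {mpoly F[n + n]}) : word_fun F letter n :=
  [ffun w => p@_(word_mnm w)].

Lemma coef_funE n (p : {mpoly F[n + n]}) w : coef_fun p w = p@_(word_mnm w).
Proof. exact: ffunE. Qed.

Lemma coef_fun_linear n : linear (@coef_fun n).
Proof. by move=> a p q; apply/ffunP => w; rewrite !ffunE mcoeffD mcoeffZ. Qed.

Lemma coef_fun_act n (s : 'S_n) (p : {mpoly F[n + n]}) :
  coef_fun (poly_act s p) = rep_act s (coef_fun p : word_rep F letter n).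
Proof.
apply/ffunP => w; rewrite word_repE !coef_funE poly_actE mcoeff_sym; congr (p@_ _).
apply/mnmP; elim/var_ind => k; rewrite mnmE ?xymap_x ?xymap_y ?word_mnm_x ?word_mnm_y word_permE //.
Qed.

Lemma coef_fun_incl n (p : {mpoly F[n + n]}) :
  coef_fun (poly_incl p) = fun_ext base_letter (coef_fun p).
Proof.
apply/ffunP => w; rewrite fun_extE !coef_funE mcoeff_incl.
have -> : no_last (word_mnm w) = (w ord_max == base_letter).
  rewrite /no_last word_mnm_x word_mnm_y.
  by case: (w ord_max) => x y; rewrite /base_letter xpair_eqE.
case: eqP => // _; congr (p@_ _); apply/mnmP; elim/var_ind => k.
  by rewrite mnmE incl_x !word_mnm_x ffunE.
by rewrite mnmE incl_y !word_mnm_y ffunE.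
Qed.

Lemma coef_fun_eq0 n (p : {mpoly F[n + n]}) : bihomog i j p -> coef_fun p = 0 -> p = 0.
Proof.
move=> hp p0; apply/mpolyP => m; rewrite mcoeff0; apply/eqP/negPn/negP.
rewrite -mcoeff_msupp => /[dup] mp /hp [hy hx].
have bx k : (m (xvar k) < j.+1)%N by rewrite ltnS -hx /xdeg (bigD1 k) //= leq_addr.
have by' k : (m (yvar k) < i.+1)%N by rewrite ltnS -hy /ydeg (bigD1 k) //= leq_addr.
pose w : word letter n := [ffun k => (Ordinal (bx k), Ordinal (by' k))].
have mE : m = word_mnm w.
  by apply/mnmP; elim/var_ind => k; rewrite ?word_mnm_x ?word_mnm_y ffunE.
have := congr1 (fun f : word_fun F letter n => f w) p0.
by rewrite coef_funE -mE ffunE => /eqP; move: mp; rewrite mcoeff_msupp => /negbTE ->.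
Qed.

Lemma coef_fun_weight n (p : {mpoly F[n + n]}) w : bihomog i j p -> coef_fun p w != 0 ->
  (weight base_letter w <= i + j)%N.
Proof.
rewrite coef_funE -mcoeff_msupp => hp /hp [<- <-].
rewrite /weight /ydeg /xdeg -big_split /= -sum1dep_card big_mkcond /=.
apply: leq_sum => k _; rewrite word_mnm_x word_mnm_y.
case: eqP => // ne; rewrite lt0n addn_eq0; apply/negP => /andP[/eqP h1 /eqP h2].
by case: ne; rewrite [LHS]surjective_pairing; congr (_, _); apply: val_inj.
Qed.

Context (mu : nat -> intpart).
Hypotheses (mu_size : forall n, sumn (parts (mu n)) = n)
  (mu_sub : forall n, diagram_sub (mu n) (mu n.+1)).

Notation G n := (GH_rep F n (parts (mu n)) i j).
Notation GC n := (@GH_comp F n (parts (mu n)) i j).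

Lemma GH_comp_incl n p : GC n p -> GC n.+1 (poly_incl p).
Proof.
move=> [Gp hp]; split; last exact: bihomog_incl.
by apply: (GH_incl (mu := mu n)).
Qed.

Lemma GH_val n (v : G n) : GC n (subrep_val v).
Proof. by apply/asboolP; exact: (valP (v : sub_sort _)). Qed.

Lemma GH_val_inj n : injective (@subrep_val _ _ _ _ _ : G n -> poly_rep F n).
Proof. by move=> u v; exact: (@val_inj _ _ (sub_sort _)). Qed.

Definition GH_mk n p (h : GC n p) : G n :=
  exist (fun u => u \in sub_pred _) p (introT (asboolP _) h).

Lemma GH_mkK n p (h : GC n p) : subrep_val (GH_mk h) = p.
Proof. by []. Qed.

Definition GH_phi n (v : G n) : G n.+1 := GH_mk (GH_comp_incl (GH_val v)).

Lemma GH_phi_linear n : linear (@GH_phi n).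
Proof. by move=> a u v; apply: GH_val_inj; rewrite /= ; exact: poly_incl_linear. Qed.

HB.instance Definition _ n := GRing.isLinear.Build F (G n) (G n.+1) _ (@GH_phi n) (@GH_phi_linear n).

Definition coef_image n (f : word_rep F letter n) : Prop := exists v : G n, coef_fun (subrep_val v) = f.

Lemma coef_val_linear n : linear (fun v : G n => coef_fun (subrep_val v) : word_rep F letter n).
Proof. by move=> a u v; rewrite -coef_fun_linear. Qed.

Lemma coef_val_act n s (v : G n) :
  coef_fun (subrep_val (rep_act s v)) = rep_act s (coef_fun (subrep_val v) : word_rep F letter n).
Proof. by rewrite -coef_fun_act. Qed.

Lemma coef_val_inj n : injective (fun v : G n => coef_fun (subrep_val v)).
Proof.
move=> u v e; have : u - v = 0; last by move/eqP; rewrite subr_eq0 => /eqP.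
apply: GH_val_inj; apply: coef_fun_eq0; first exact: (GH_val (u - v)).2.
have -> : u - v = (-1) *: v + u by rewrite scaleN1r addrC.
have ev : coef_fun (subrep_val u) = coef_fun (subrep_val v) := e.
apply: etrans (coef_val_linear (-1) v u) _.
by rewrite /= ev scaleN1r addNr.
Qed.

Lemma coef_image_submodule n : is_submodule (@coef_image n).
Proof.
split.
- by exists 0; apply: linear_fun0 (@coef_val_linear n).
- by move=> a f g [u <-] [v <-]; exists (a *: u + v); apply: coef_val_linear.
- by move=> s f [v <-]; exists (rep_act s v); apply: coef_val_act.
Qed.

Lemma coef_image_ext n f : coef_image f -> coef_image (fun_ext base_letter f : word_rep F letter n.+1).
Proof. by move=> [v <-]; exists (GH_phi v); rewrite GH_mkK coef_fun_incl. Qed.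

Lemma coef_image_weight n f w : @coef_image n f -> (f : word_fun F letter n) w != 0 ->
  (weight base_letter w <= i + j)%N.
Proof. by move=> [v <-]; apply: coef_fun_weight; apply: (GH_val v).2. Qed.

Theorem GH_stable : uniformly_rep_stable (fun n => (@GH_phi n : {linear G n -> G n.+1})).
Proof.
split=> [n s v|]; first by apply: GH_val_inj; exact: poly_incl_act.
split=> [n v|]; first by apply: GH_val_inj; exact: poly_incl_last_swap.
pose T n lam := std_tableau lam n.
exists (fun lam n => mult (coef_image_submodule n) (T n) lam); split.
  by move=> lam n /negbTE h; rewrite /mult h.
split.
  move=> n; apply: rep_iso_trans (word_decomposition (coef_image_submodule n) (T n)).
  have [|//|_] // := iso_of_image (coef_image_submodule n) (@coef_val_linear n) (@coef_val_inj n).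
  by move=> s w; apply: coef_val_act.
have [N NP] := word_family_stable coef_image_submodule coef_image_ext coef_image_weight.
exists N => n /NP [multE gen]; split=> // [u v e|W HW WS v].
  by apply: GH_val_inj; apply: (@poly_incl_inj F); exact: (congr1 (@subrep_val _ _ _ _ _) e).
pose Z (f : word_rep F letter n.+1) := exists2 u, W u & coef_fun (subrep_val u) = f.
have HZ : is_submodule Z.
  split.
  - by exists 0; [exact: submod0 HW | apply: linear_fun0 (@coef_val_linear n.+1)].
  - move=> a f g [u Wu <-] [u' Wu' <-]; exists (a *: u + u'); last exact: coef_val_linear.
    by apply: (submodD HW) => //; apply: (submodZ HW).
  - by move=> s f [u Wu <-]; exists (rep_act s u); [exact: submodA | exact: coef_val_act].
have SZ f : coef_image f -> Z (fun_ext base_letter f : word_rep F letter n.+1).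
  move=> [u <-]; exists (GH_phi u); first by apply: WS; exists u.
  by rewrite GH_mkK coef_fun_incl.
have [u Wu e] := gen Z HZ SZ (coef_fun (subrep_val v)) (ex_intro _ v erefl).
by rewrite -(coef_val_inj e).
Qed.

End Coefficients.

Theorem proposition5p2p2 (R : realType) (mu : nat -> intpart)
    (mu_size : forall n, sumn (parts (mu n)) = n)
    (mu_sub : forall n, diagram_sub (mu n) (mu n.+1))
    (i j : nat) :
  exists phi : forall n,
      {linear GH_rep (complex R) n (parts (mu n)) i j ->
              GH_rep (complex R) n.+1 (parts (mu n.+1)) i j},
    (forall n v, subrep_val (phi n v) = poly_incl (subrep_val v)) /\
    uniformly_rep_stable phi.
Proof.
exists (fun n => @GH_phi (complex R) i j mu mu_size mu_sub n
  : {linear GH_rep (complex R) n (parts (mu n)) i j ->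
            GH_rep (complex R) n.+1 (parts (mu n.+1)) i j}).
split=> [n v|]; [exact: GH_mkK | exact: GH_stable].
Qed.
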